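(* Let $\mathcal S=\{D_1,\dots,D_m\}\subset\mathbb C^{d\times d}$ be a family of diagonal matrices $D_i=\operatorname{diag}(\lambda^{(i)}_1,\dots,\lambda^{(i)}_d)$ with all $\lambda_j^{(i)}\neq 0$, with probability weights $p_1,\dots,p_m$, and suppose that $|\lambda_1^{(i)}|>\max_{r\ne 1}|\lambda_r^{(i)}|$ for every $i=1,\dots,m$. Let $Z_1$ be a random variable taking the value $\log|\lambda_1^{(i)}|$ with probability $p_i$, and set $\mu_Z:=\mathbb E[Z_1]=\log\rho_\infty(\mathcal S,\mathbb P_{\mathcal S})$, $\sigma_Z^2:=\operatorname{Var}(Z_1)$. Then $$\sqrt n\,\bigl(\rho_n(\mathcal S,\mathbb P_{\mathcal S})-\rho_\infty(\mathcal S,\mathbb P_{\mathcal S})\bigr)\xRightarrow{d}\mathcal N\bigl(0,\sigma_\infty^2(\mathcal S,\mathbb P_{\mathcal S})\bigr),$$ where $\sigma_\infty^2(\mathcal S,\mathbb P_{\mathcal S})=\rho_\infty^2(\mathcal S,\mathbb P_{\mathcal S})\,\sigma_Z^2$. If $\sigma_Z^2>0$, then for every $x\in\mathbb R$ $$\lim_{n\to\infty}\mathbb P\left(\frac{\rho_n(\mathcal S,\mathbb P_{\mathcal S})-\rho_\infty(\mathcal S,\mathbb P_{\mathcal S})}{n^{-1/2}\sigma_\infty(\mathcal S,\mathbb P_{\mathcal S})}<x\right)=\Phi(x).$$ If $\sigma_Z^2=0$, then $\rho_n=\rho_\infty$ almost surely for every $n$ and the limiting fluctuation is degenerate (identically 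$0$).
   Context: $\mathbb P_{\mathcal S}$ assigns mass $p_i\ge 0$ to $D_i$, with $\sum_i p_i=1$. Let $(i_k)_{k\ge1}$ be i.i.d. random indices in $\{1,\dots,m\}$ with $\mathbb P(i_k=i)=p_i$. The random spectral radius of length $n$ is $\rho_n(\mathcal S,\mathbb P_{\mathcal S}):=\rho(D_{i_n}\cdots D_{i_1})^{1/n}$, where $\rho(\cdot)$ is the spectral radius. Further $\rho_\infty(\mathcal S,\mathbb P_{\mathcal S}):=\prod_{i=1}^m|\lambda_1^{(i)}|^{p_i}$. $\Phi$ is the standard normal cumulative distribution function, and $\mathcal N(0,0)$ is the Dirac mass at $0$. *)

(* Defs.v *)
From HB Require Import structures.
From mathcomp Require Import all_boot all_order all_algebra finmap complex.
From mathcomp Require Import all_classical all_reals all_analysis.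
From mathcomp Require Import measurable_realfun.

Set Implicit Arguments.
Unset Strict Implicit.
Unset Printing Implicit Defensive.

Import Order.TTheory GRing.Theory Num.Theory.
Import numFieldNormedType.Exports.

Local Open Scope classical_set_scope.
Local Open Scope ring_scope.

(* Measurable types are pointed in the library, whence 'I_m.+1: the number of
   matrices is written m.+1, which is no restriction since weights summing to 1
   exist only on a nonempty index set. *)
HB.instance Definition _ (m : nat) := isPointed.Build 'I_m.+1 ord0.
HB.instance Definition _ (m : nat) := @isMeasurable.Build
  default_measure_display 'I_m.+1 discrete_measurable discrete_measurable0
  discrete_measurableC discrete_measurableU.

(* The set is finite, and nonempty when d > 0, so that its [sup] is a maximum.
   [eigenvalue] is stated with row vectors; left and right spectra agree. *)
Definition spectral_radius (R : realType) (d : nat) (A : 'M[R[i]]_d) : R :=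
  sup [set Normc.normc z | z in [set z : R[i] | eigenvalue A z]].

Definition mutually_independent (disp disp' : measure_display)
    (Omega : measurableType disp) (T : measurableType disp') (R : realType)
    (P : probability Omega R) (X : nat -> {RV P >-> T}) : Prop :=
  forall (J : {fset nat}) (B : nat -> set T),
    (forall k, measurable (B k)) ->
    P (\bigcap_(k in [set` J]) (X k @^-1` B k)) =
      (\prod_(k <- J) P (X k @^-1` B k))%E.

Section RandomProducts.
Context (disp : measure_display) (Omega : measurableType disp) (R : realType).
Context (P : probability Omega R) (m d : nat).
Variables (D : 'I_m.+1 -> 'M[R[i]]_d) (idx : nat -> {RV P >-> 'I_m.+1}).

(* [idx] is numbered from 0, so [random_product n] is D_{i_n} ... D_{i_1}
   with i_k = [idx k.-1]. *)
Fixpoint random_product (n : nat) (w : Omega) : 'M[R[i]]_d :=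
  if n is n'.+1 then D (idx n' w) *m random_product n' w else 1%:M.

Definition random_spectral_radius (n : nat) (w : Omega) : R :=
  spectral_radius (random_product n w) `^ (n%:R^-1).

Lemma measurable_random_product n (A : set 'M[R[i]]_d) :
  measurable (random_product n @^-1` A).
Proof.
elim: n A => [|n IHn] A.
  have [A1|A1] := pselect (A 1%:M).
    rewrite (_ : _ @^-1` A = setT); first exact: measurableT.
    by rewrite -subTset.
  by rewrite (_ : _ @^-1` A = set0)// -subset0.
rewrite (_ : _ @^-1` A = \big[setU/set0]_(i < m.+1)
    ((idx n @^-1` [set i]) `&`
     (random_product n @^-1` [set M | A (D i *m M)]))); last first.
  apply/seteqP; split=> w; rewrite -bigcup_mkord_ord /=.
    by move=> Aw; exists (idx n w) => //=; rewrite inord_val.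
  by move=> [k _ [/= <-]].
apply: bigsetU_measurable => i _; apply: measurableI; last exact: IHn.
by rewrite -[X in measurable X]setTI; exact: measurable_funP.
Qed.

Lemma measurable_random_spectral_radius n :
  measurable_fun setT (random_spectral_radius n).
Proof.
move=> _ Y _; rewrite setTI.
exact: (measurable_random_product n
  [set M | Y (spectral_radius M `^ (n%:R^-1))]).
Qed.

HB.instance Definition _ n := isMeasurableFun.Build _ _ _ _
  (random_spectral_radius n) (@measurable_random_spectral_radius n).

End RandomProducts.

Definition asymptotic_spectral_radius (R : realType) (m d : nat)
    (p : 'I_m.+1 -> R) (lam : 'I_m.+1 -> 'rV[R[i]]_d.+1) : R :=
  \prod_(i < m.+1) Normc.normc (lam i ord0 ord0) `^ p i.

Definition cvg_in_distribution (disp : measure_display)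
    (Omega : measurableType disp) (R : realType) (P : probability Omega R)
    (X : nat -> {RV P >-> R}) (nu : probability (measurableTypeR R) R) : Prop :=
  forall f : R -> R, continuous f -> bounded_fun f ->
    'E_P[f \o X n]%E @[n --> \oo] --> (\int[nu]_x (f x)%:E)%E.

Definition dirac_law (R : realType) (a : R) :
    probability (measurableTypeR R) R :=
  \d_(a : measurableTypeR R).

(* [normal_law mean var] is parametrised by its variance. The case distinction
   is needed because the library's [normal_prob mean 0] is the uniform law on
   [0, 1] rather than the Dirac mass at [mean]. *)
Definition normal_law (R : realType) (mean var : R) :
    probability (measurableTypeR R) R :=
  if var == 0 then dirac_law mean else normal_prob mean (Num.sqrt var).

Definition std_normal_cdf (R : realType) (x : R) : \bar R :=
  normal_prob 0 1 `]-oo, x].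

(* Main.v *)
(** Since the first entry dominates in every factor, the spectral radius of the
random product is the product of the |lambda_1|, so rho_n is the exponential of the
mean of n i.i.d. variables with finitely many values, and the fluctuation statement
is a delta method applied to the central limit theorem for these.

The central limit theorem is proved by Lindeberg replacement in Trotter's operator
form. Let A be the averaging operator of one centred step divided by sqrt n and N_s
the Gaussian averaging operator. Both agree to second order on functions with a cubic
Taylor remainder, so A f - N_(s / sqrt n) f is O(n^(-3/2)); the semigroup law of N_s
and contractivity then give A^n f - N_s f = O(n^(-1/2)) at 0. A C^2 step function
sandwiches the indicators of half-lines, which gives convergence of the distribution
functions, first for the sums and then, after taking logarithms in the threshold, for
rho_n. Finally, a bounded continuous function is uniformly close to a step function
outside a set of small mass, which gives convergence in distribution. *)

Require Import Defs.
From HB Require Import structures.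
From mathcomp Require Import all_boot all_order all_algebra finmap complex.
From mathcomp Require Import all_classical all_reals all_analysis.
From mathcomp Require Import measurable_realfun.
From mathcomp Require Import ring lra.

Set Implicit Arguments.
Unset Strict Implicit.
Unset Printing Implicit Defensive.

Import Order.TTheory GRing.Theory Num.Theory.
Import numFieldNormedType.Exports.

Local Open Scope classical_set_scope.
Local Open Scope ring_scope.

(** * Gaussian averages *)

Section gaussian_average.
Context {R : realType}.
Notation mu := (@lebesgue_measure R).
Implicit Types (m s x y : R) (f : R -> R).

(* Only used with [s > 0]: [normal_pdf m 0] is the density of the uniform law on
   [0, 1], not a Dirac mass. *)
Definition gauss_avg m s f : R := \int[mu]_x (f x * normal_pdf m s x).

Lemma integrable_bounded_normal_pdf m s f (M : R) :
  measurable_fun setT f -> (forall x, `|f x| <= M) ->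
  mu.-integrable setT (fun x => (f x * normal_pdf m s x)%:E).
Proof.
move=> mf fM.
have M0 : 0 <= M by apply: le_trans (fM 0).
apply: (@le_integrable _ _ _ mu setT measurableT _
   (fun x => M%:E * (normal_pdf m s x)%:E)%E).
- by apply/measurable_EFinP; apply: measurable_funM => //; exact: measurable_normal_pdf.
- move=> x _; rewrite -EFinM !abse_EFin lee_fin !normrM.
  by apply: ler_wpM2r => //; rewrite (ger0_norm M0).
- by apply: integrableZl => //; exact: integrable_normal_pdf.
Qed.

Lemma normal_pdf_scale m s x : 0 < s ->
  normal_pdf m s x = normal_pdf 0 1 ((x - m) / s) / s.
Proof.
move=> s0; rewrite !normal_pdfE ?oner_eq0 ?gt_eqF//=.
rewrite /normal_peak /normal_fun [RHS]mulrAC.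
congr (_ * _).
  rewrite expr1n mul1r -mulrnAr sqrtrM ?sqr_ge0// sqrtr_sqr gtr0_norm//.
  by rewrite invfM mulrC.
congr expR; rewrite expr1n subr0; field.
by rewrite gt_eqF.
Qed.

(** Substitution z = (x - m) / s; nonnegativity of [f] gives access to the rule for nonnegative
    integrands. *)
Lemma gauss_avg_std m s f : 0 < s -> continuous f -> (forall x, 0 <= f x) ->
  gauss_avg m s f = \int[mu]_z (f (m + s * z) * normal_pdf 0 1 z).
Proof.
move=> s0 cf f0; rewrite /gauss_avg /Rintegral; congr fine.
pose F x := (x - m) / s; pose G z := f (m + s * z) * normal_pdf 0 1 z.
have F'E : F^`()%classic = cst s^-1.
  apply/funext => x; rewrite /F derive1E deriveM// deriveD// derive_cst scaler0.
  by rewrite add0r derive_id derive_cst addr0 scaler1.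
have Fd x : derivable F x 1 by apply: derivableM => //.
rewrite [RHS](@increasing_ge0_integration_by_substitutionT R F G); last 9 first.
- by move=> x y xy; rewrite /F ltr_pM2r ?invr_gt0// ltrD2r.
- by rewrite F'E => x; exact: cvg_cst.
- by rewrite F'E; exact: is_cvg_cst.
- by rewrite F'E; exact: is_cvg_cst.
- by [].
- by apply/gt0_cvgMlNy; [rewrite invr_gt0|exact: cvg_addrr_Ny].
- by apply/gt0_cvgMly; [rewrite invr_gt0|exact: cvg_addrr].
- move=> x; apply: cvgM; last by apply: continuous_normal_pdf; rewrite oner_eq0.
  apply: (cvg_comp (fun z => m + s * z) f); last exact: cf.
  apply: cvgD; first exact: cvg_cst.
  by apply: cvgM; [exact: cvg_cst|exact: cvg_id].
- by move=> x; rewrite mulr_ge0 ?normal_pdf_ge0.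
apply: eq_integral => x _; congr EFin; rewrite F'E /G /F/= !fctE -mulrA; congr (f _ * _).
  by rewrite mulrC divfK ?gt_eqF// addrC subrK.
by rewrite [LHS]normal_pdf_scale.
Qed.

Lemma std_normal_pdfE z : normal_pdf 0 1 z = normal_peak (1 : R) * expR (- z ^+ 2 / 2).
Proof. by rewrite normal_pdfE ?oner_eq0// /normal_fun subr0 expr1n. Qed.

Lemma std_normal_pdfN z : normal_pdf 0 1 (- z) = normal_pdf (0 : R) 1 z.
Proof. by rewrite !std_normal_pdfE sqrrN. Qed.

(** The density of deviation 2 leaves a spare factor exp (3 z^2 / 8) to absorb the cubic. The
    constant 62 is the ratio 2 of the two peaks times a generous 31. *)
Lemma cubic_std_normal_pdf_le z :
  (1 + `|z| ^+ 3) * normal_pdf 0 1 z <= 62 * normal_pdf (0 : R) 2 z.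
Proof.
rewrite (@normal_pdf_scale 0 2)// subr0 !std_normal_pdfE.
set e := expR (- (z / 2) ^+ 2 / 2).
have -> : expR (- z ^+ 2 / 2) = e * expR (- (3 * z ^+ 2 / 8)).
  by rewrite /e -expRD; congr expR; field.
rewrite (_ : 62 * _ = normal_peak 1 * e * 31); last by field.
set X := expR (- (3 * _ / _)).
rewrite (_ : (1 + _) * _ = normal_peak 1 * e * ((1 + `|z| ^+ 3) * X)); last by ring.
apply: ler_wpM2l; first by rewrite mulr_ge0 ?normal_peak_ge0 ?expR_ge0.
rewrite /X expRN ler_pdivrMr ?expR_gt0//.
(* The exponent is halved so that 1 + t <= exp t can be squared: this gives a quartic in z, while
   the unsplit bound would only be quadratic. *)
have -> : 3 * z ^+ 2 / 8 = 3 * z ^+ 2 / 16 *+ 2 by field.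
rewrite mulr2n expRD.
have H := expR_ge1Dx (3 * z ^+ 2 / 16).
have z2 : z ^+ 2 = `|z| ^+ 2 by rewrite real_normK ?num_real.
move: H; rewrite z2; set a := `|z|; set E := expR _ => H.
have a0 : 0 <= a by exact: normr_ge0.
have H2 : (1 + 3 * a ^+ 2 / 16) ^+ 2 <= E * E.
  by rewrite -expr2 lerXn2r ?nnegrE ?expR_ge0//; nra.
apply: (@le_trans _ _ (31 * (1 + 3 * a ^+ 2 / 16) ^+ 2)); last by rewrite ler_pM2l.
nra.
Qed.

Lemma integrable_cubic_std_normal (g : R -> R) (c : R) :
  measurable_fun setT g -> (forall z, `|g z| <= c * (1 + `|z| ^+ 3)) ->
  mu.-integrable setT (fun z => (g z * normal_pdf 0 1 z)%:E).
Proof.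
move=> mg gc.
have c0 : 0 <= c by have := gc 0; rewrite normr0 expr0n addr0 mulr1; apply: le_trans.
apply: (@le_integrable _ _ _ mu setT measurableT _
   (fun x => (c * 62)%:E * (normal_pdf 0 2 x)%:E)%E).
- by apply/measurable_EFinP; apply: measurable_funM => //; exact: measurable_normal_pdf.
- move=> x _; rewrite -EFinM !abse_EFin lee_fin !normrM.
  rewrite !(ger0_norm (normal_pdf_ge0 _ _ _)).
  rewrite (ger0_norm c0) (ger0_norm (ler0n _ 62)).
  apply: le_trans (ler_wpM2r (normal_pdf_ge0 _ _ _) (gc x)) _.
  by rewrite -!mulrA ler_wpM2l ?cubic_std_normal_pdf_le.
- by apply: integrableZl => //; exact: integrable_normal_pdf.
Qed.

Lemma integrable_expr_std_normal k : (k <= 3)%N ->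
  mu.-integrable setT (fun z => (z ^+ k * normal_pdf 0 1 z)%:E).
Proof.
move=> k3; apply: (@integrable_cubic_std_normal _ 1); first exact: measurable_funX.
move=> z; rewrite mul1r normrX.
have [z1|z1] := leP `|z| 1.
  by rewrite ler_wpDr ?exprn_ge0// exprn_ile1.
by rewrite ler_wpDl// ler_eXn2l.
Qed.

Lemma RintegralN_lebesgue (g : R -> R) : mu.-integrable setT (EFin \o g) ->
  \int[mu]_z g (- z) = \int[mu]_z g z.
Proof.
move=> ig; rewrite /Rintegral; congr fine.
have mg : measurable_fun setT (EFin \o g) by case/integrableP: ig.
have mN : measurable_fun setT (-%R : R -> R) by exact: oppr_measurable.
rewrite [RHS](@eq_measure_integral _ _ _ _ (pushforward mu (-%R : R -> measurableTypeR R))).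
  rewrite integral_pushforward//.
  rewrite preimage_setT.
  apply/integrableP; split; first exact: measurableT_comp.
  case/integrableP: ig => _; apply: le_lt_trans.
  rewrite [leRHS](@eq_measure_integral _ _ _ _ (pushforward mu (-%R : R -> measurableTypeR R))).
    rewrite ge0_integral_pushforward//.
    exact: measurableT_comp.
  by move=> A mA _; exact/esym/lebesgue_measureN.
by move=> A mA _; exact/esym/lebesgue_measureN.
Qed.

(** The reflection z -> -z turns the integral into its opposite. *)
Lemma std_normal_moment1 : \int[mu]_z (z * normal_pdf 0 1 z) = 0.
Proof.
have := RintegralN_lebesgue (integrable_expr_std_normal (isT : (1 <= 3)%N)).
under eq_Rintegral do rewrite expr1 std_normal_pdfN mulNr -mulN1r.
rewrite RintegralZl//; last exact: (integrable_expr_std_normal (isT : (1 <= 3)%N)).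
under [X in _ = X]eq_Rintegral do rewrite expr1.
move=> H; lra.
Qed.

(** Since exp (z^2 / 2) exceeds z^2 / 2, the product is at most 2 [normal_peak 1] / z for positive
    z. *)
Lemma cvg_id_std_normal_pdf : z * normal_pdf 0 1 z @[z --> +oo] --> (0 : R).
Proof.
have p0 := normal_peak_ge0 (1 : R).
apply: (@squeeze_cvgr _ _ _ _ (cst 0) (fun z : R => normal_peak 1 * 2 * z^-1)).
- near=> z; have z0 : 0 < z by [].
  apply/andP; split; first by rewrite mulr_ge0 ?normal_pdf_ge0 ?ltW.
  rewrite std_normal_pdfE mulrCA -[leRHS]mulrA ler_wpM2l// mulNr expRN.
  rewrite ler_pdivrMr ?expR_gt0// mulrAC ler_pdivlMr//.
  have := expR_ge1Dx (z ^+ 2 / 2); set E := expR _ => H.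
  lra.
- exact: cvg_cst.
- rewrite -[X in _ --> X](mulr0 (normal_peak 1 * 2)); apply: cvgMl_tmp.
  by apply/gtr0_cvgV0 => //; near=> z.
Unshelve. all: by end_near. Qed.

Lemma is_derive_id_std_normal_pdf (z : R) : is_derive z 1
  (fun z => - (z * normal_pdf 0 1 z)) ((z ^+ 2 - 1) * normal_pdf 0 1 z).
Proof.
rewrite (_ : (fun z => _) = (fun z => - (z * (normal_peak 1 * expR (- z ^+ 2 / 2))))); last first.
  by apply/funext => x; rewrite std_normal_pdfE.
apply: is_derive_eq.
rewrite std_normal_pdfE /= !scaler0 ?addr0 ?add0r /GRing.scale /=.
by field.
Qed.

Lemma continuous_sqrB1_std_normal_pdf : continuous (fun z : R => (z ^+ 2 - 1) * normal_pdf 0 1 z).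
Proof.
move=> z; apply: cvgM; last by apply: continuous_normal_pdf; rewrite oner_eq0.
by apply: cvgB; [exact: exprn_continuous|exact: cvg_cst].
Qed.

(* [- z * normal_pdf 0 1 z] is an antiderivative; the half-line is cut at 1 because
   the fundamental theorem on [1, +oo[ requires an integrand of constant sign. *)
Lemma std_normal_half_moment2 :
  \int[mu]_(z in `[0, +oo[) ((z ^+ 2 - 1) * normal_pdf 0 1 z) = 0.
Proof.
pose F (z : R) := - (z * normal_pdf 0 1 z).
have dF z : derivable F z 1 by have [] := is_derive_id_std_normal_pdf z.
have F'E z : F^`()%classic z = (z ^+ 2 - 1) * normal_pdf 0 1 z.
  by rewrite derive1E; have [_] := is_derive_id_std_normal_pdf z.
have cF (z : R) : {for z, continuous F}.
  by apply: differentiable_continuous; exact/derivable1_diffP.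
have H1 : \int[mu]_(z in `[1, +oo[) ((z ^+ 2 - 1) * normal_pdf 0 1 z) = 0 - F 1.
  apply: Rintegral_ge0_continuous_FTC2y.
  - move=> z z1; rewrite mulr_ge0 ?normal_pdf_ge0// subr_ge0.
    by rewrite exprn_ege1.
  - by apply: continuous_subspaceT; exact: continuous_sqrB1_std_normal_pdf.
  - by rewrite -oppr0; apply: cvgN; exact: cvg_id_std_normal_pdf.
  - by [].
  - by apply: cvg_at_right_filter; exact: cF.
  - by move=> z _; rewrite F'E.
have H2 : \int[mu]_(z in `[0, 1]) ((z ^+ 2 - 1) * normal_pdf 0 1 z) = F 1 - F 0.
  rewrite /Rintegral (@continuous_FTC2 _ _ F)//.
  - by apply: continuous_subspaceT; exact: continuous_sqrB1_std_normal_pdf.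
  - by split => //; [apply: cvg_at_right_filter|apply: cvg_at_left_filter]; exact: cF.
have ih : mu.-integrable setT (fun z => ((z ^+ 2 - 1) * normal_pdf 0 1 z)%:E).
  apply: (@integrable_cubic_std_normal _ 2).
    by apply: measurable_funB => //; exact: measurable_funX.
  move=> z; apply: le_trans (ler_normB _ _) _; rewrite normr1 normrX.
  by have := normr_ge0 z; set a := `|z| => a0; have := mulr_ge0 a0 (sqr_ge0 (a - 1)); nra.
have ih0 : mu.-integrable `[0, +oo[ (EFin \o (fun z => (z ^+ 2 - 1) * normal_pdf 0 1 z)).
  by apply: (integrableS _ _ _ ih) => //; exact: measurable_itv.
have := Rintegral_itvB (x := 1) ih0.
rewrite !bnd_simp => /(_ ler01 isT); rewrite H2 Rintegral_itv_obnd_cbnd ?H1.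
  rewrite /F mul0r; lra.
by apply: (integrableS _ _ _ ih) => //; exact: measurable_itv.
Qed.

End gaussian_average.

(** * Second moment, Taylor expansion and convolution of Gaussian densities *)

Section gaussian_moments.
Context {R : realType}.
Notation mu := (@lebesgue_measure R).
Implicit Types (m s x y : R) (f : R -> R).

(** By evenness the second moment and the total mass are both twice their half-line parts, and these
    parts coincide by [std_normal_half_moment2]. *)
Lemma std_normal_moment2 : \int[mu]_z (z ^+ 2 * normal_pdf 0 1 z) = 1.
Proof.
have i2 : mu.-integrable `[0, +oo[ (EFin \o (fun z => z ^+ 2 * normal_pdf 0 1 z)).
  have i2T := @integrable_expr_std_normal R 2 isT.
  by apply: (integrableS _ _ _ i2T) => //; exact: measurable_itv.
have i0 : mu.-integrable `[0, +oo[ (EFin \o (fun z : R => normal_pdf 0 1 z)).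
  have i0T := integrable_normal_pdf (0 : R) 1.
  by apply: (integrableS _ _ _ i0T) => //; exact: measurable_itv.
have E : \int[mu]_(z in `[0, +oo[) (z ^+ 2 * normal_pdf 0 1 z) =
         \int[mu]_(z in `[0, +oo[) normal_pdf 0 1 z.
  apply/eqP; rewrite -subr_eq0 -RintegralB//.
  rewrite -[X in _ == X]std_normal_half_moment2; apply/eqP/eq_Rintegral => z _.
  by rewrite mulrBl mul1r.
rewrite /Rintegral ge0_symfun_integralT; first last.
- by move=> z /=; rewrite sqrrN std_normal_pdfN.
- move=> z; apply: cvgM; first exact: exprn_continuous.
  by apply: continuous_normal_pdf; rewrite oner_eq0.
- by move=> z; rewrite mulr_ge0 ?sqr_ge0 ?normal_pdf_ge0.
rewrite -set_itvcy -(fineK (integrable_fin_num _ i2))//.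
move: E; rewrite /Rintegral => ->.
rewrite fineK; last exact: (integrable_fin_num _ i0).
rewrite set_itvcy -ge0_symfun_integralT ?integral_normal_pdf//.
- by move=> z; exact: normal_pdf_ge0.
- by apply: continuous_normal_pdf; rewrite oner_eq0.
- by move=> z /=; rewrite std_normal_pdfN.
Qed.

Definition std_normal_abs_moment3 : R := \int[mu]_z (`|z| ^+ 3 * normal_pdf 0 1 z).

(** In the variable m + s z the quadratic part integrates exactly, the moments of order 0, 1, 2
    being 1, 0, 1; only the cubic remainder is left. *)
Lemma gauss_avg_taylor m s f (a b C : R) : 0 < s -> continuous f ->
  (forall x, 0 <= f x <= 1) ->
  (forall h, `|f (m + h) - f m - a * h - b * h ^+ 2| <= C * `|h| ^+ 3) ->
  `|gauss_avg m s f - f m - b * s ^+ 2| <= C * s ^+ 3 * std_normal_abs_moment3.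
Proof.
move=> s0 cf f01 fC.
rewrite gauss_avg_std//; last by move=> x; have /andP[] := f01 x.
have mpdf : measurable_fun setT (normal_pdf (0 : R) 1) by exact: measurable_normal_pdf.
have i0 : mu.-integrable setT (EFin \o (fun z : R => normal_pdf 0 1 z)).
  exact: integrable_normal_pdf.
have i1 : mu.-integrable setT (EFin \o (fun z => z * normal_pdf 0 1 z)).
  exact: (integrable_expr_std_normal (isT : (1 <= 3)%N)).
have i2 : mu.-integrable setT (EFin \o (fun z => z ^+ 2 * normal_pdf 0 1 z)).
  exact: (integrable_expr_std_normal (isT : (2 <= 3)%N)).
have i3 : mu.-integrable setT (EFin \o (fun z => `|z| ^+ 3 * normal_pdf 0 1 z)).
  apply: (@integrable_cubic_std_normal R _ 1).
    by apply: measurable_funX; exact: normr_measurable.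
  by move=> z; rewrite mul1r ger0_norm ?lerDr// exprn_ge0.
have iZ (k : R) g : mu.-integrable setT (EFin \o g) ->
    mu.-integrable setT (EFin \o (fun z => k * g z)).
  by move=> ig; exact: (integrableZl measurableT k ig).
have iD g h : mu.-integrable setT (EFin \o g) -> mu.-integrable setT (EFin \o h) ->
    mu.-integrable setT (EFin \o (fun z => g z + h z)).
  by move=> ig ih; exact: (integrableD measurableT ig ih).
have mfs : measurable_fun setT (fun z => f (m + s * z)).
  apply: (measurableT_comp (f := f)); first exact: continuous_measurable_fun.
  by apply: measurable_funD => //; exact: measurable_funM.
have if_ : mu.-integrable setT (EFin \o (fun z => f (m + s * z) * normal_pdf 0 1 z)).
  apply: (@integrable_bounded_normal_pdf R 0 1 _ 1) => // x.
  by have /andP[? ?] := f01 (m + s * x); rewrite ger0_norm.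
(* The quadratic Taylor polynomial at m in the increment s z, times the density. *)
pose T z := f m * normal_pdf 0 1 z + (a * s) * (z * normal_pdf 0 1 z)
  + (b * s ^+ 2) * (z ^+ 2 * normal_pdf 0 1 z).
have iT : mu.-integrable setT (EFin \o T) by apply: (iD); [apply: (iD)|]; exact: (iZ).
have -> : \int[mu]_z (f (m + s * z) * normal_pdf 0 1 z) - f m - b * s ^+ 2 =
    \int[mu]_z (f (m + s * z) * normal_pdf 0 1 z - T z).
  rewrite RintegralB// /T RintegralD//; [|by apply: (iD); exact: (iZ)|exact: (iZ)].
  rewrite RintegralD//; [|exact: (iZ)|exact: (iZ)].
  rewrite !RintegralZl// std_normal_moment1 std_normal_moment2.
  rewrite (_ : \int[mu]_z normal_pdf 0 1 z = 1) ?(mulr1, mulr0); first by ring.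
  by rewrite /Rintegral integral_normal_pdf.
have iB : mu.-integrable setT (EFin \o (fun z => f (m + s * z) * normal_pdf 0 1 z - T z)).
  exact: (integrableB measurableT if_ iT).
apply: le_trans (le_normr_Rintegral measurableT iB) _.
rewrite /std_normal_abs_moment3 -RintegralZl//.
apply: le_Rintegral => //; [exact: integrable_norm|exact: (iZ)|].
move=> z _; rewrite /T.
rewrite (_ : _ - _ = (f (m + s * z) - f m - a * (s * z) - b * (s * z) ^+ 2) *
  normal_pdf 0 1 z); last by ring.
rewrite normrM (ger0_norm (normal_pdf_ge0 _ _ _)) [leRHS]mulrA.
apply: ler_wpM2r; first exact: normal_pdf_ge0.
by apply: le_trans (fC _) _; rewrite normrM (gtr0_norm s0) exprMn mulrA.
Qed.

Lemma std_normal_abs_moment3_ge0 : 0 <= std_normal_abs_moment3.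
Proof.
by apply: Rintegral_ge0 => z _; rewrite mulr_ge0 ?normal_pdf_ge0 ?exprn_ge0.
Qed.

Lemma normal_peakE s : 0 < s -> normal_peak s = (s * Num.sqrt (pi *+ 2))^-1.
Proof.
move=> s0; rewrite /normal_peak -mulrnAr sqrtrM ?sqr_ge0//.
by rewrite sqrtr_sqr gtr0_norm.
Qed.

(** Completion of the square in y. In Bayesian terms, likelihood times prior equals the marginal of
    x times the posterior of y, which has mean a^2 x / c^2 and deviation a b / c. *)
Lemma normal_pdf_conv (a b c x y : R) : 0 < a -> 0 < b -> 0 < c ->
  c ^+ 2 = a ^+ 2 + b ^+ 2 ->
  normal_pdf y b x * normal_pdf 0 a y =
  normal_pdf 0 c x * normal_pdf (a ^+ 2 * x / c ^+ 2) (a * b / c) y.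
Proof.
move=> a0 b0 c0 abc.
have d0 : 0 < a * b / c by rewrite divr_gt0 ?mulr_gt0.
rewrite !normal_pdfE ?gt_eqF//= !normal_peakE// /normal_fun.
have q0 : 0 < Num.sqrt (pi *+ 2) :> R by rewrite sqrtr_gt0 mulrn_wgt0// pi_gt0.
have [a1 b1 c1 q1] : [/\ a != 0, b != 0, c != 0 & Num.sqrt (pi *+ 2) != 0 :> R].
  by rewrite !gt_eqF.
rewrite mulrACA -expRD [RHS]mulrACA -expRD; congr (_ * expR _).
  by field; rewrite q1 b1 a1 c1.
have s1 : a ^+ 2 + b ^+ 2 != 0 by rewrite -abc expf_neq0.

have -> : (a * b / c) ^+ 2 = a ^+ 2 * b ^+ 2 / (a ^+ 2 + b ^+ 2).
  by rewrite -abc; field.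
by rewrite abc; field; apply/and3P.
Qed.

Lemma measurable_normal_pdf2 b : b != 0 ->
  measurable_fun setT (fun u : R * R => normal_pdf u.1 b u.2).
Proof.
move=> b0; rewrite /normal_pdf (negbTE b0).
apply: measurable_funM => //; apply: measurableT_comp => //=.
apply: measurable_funM => //=; apply: measurableT_comp => //=.
by apply: measurable_funX; exact: measurable_funB.
Qed.

End gaussian_moments.

(** * The Gaussian averages as a contraction semigroup *)

Section gaussian_semigroup.
Context {R : realType}.
Notation mu := (@lebesgue_measure R).
Implicit Types (m s x y : R) (f g : R -> R).

Lemma EFin_gauss_avg m s f : measurable_fun setT f -> (forall x, 0 <= f x <= 1) ->
  (gauss_avg m s f)%:E = (\int[mu]_x (f x * normal_pdf m s x)%:E)%E.
Proof.
move=> mf f01; rewrite fineK//; apply: integrable_fin_num => //.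
apply: (@integrable_bounded_normal_pdf R m s f 1) => // x.
by have /andP[? ?] := f01 x; rewrite ger0_norm.
Qed.

Lemma le_gauss_avg m s f g : measurable_fun setT f -> measurable_fun setT g ->
  (forall x, 0 <= f x <= 1) -> (forall x, 0 <= g x <= 1) ->
  (forall x, f x <= g x) -> gauss_avg m s f <= gauss_avg m s g.
Proof.
move=> mf mg f01 g01 fg; rewrite -lee_fin !EFin_gauss_avg//.
have f0 x : 0 <= f x by have /andP[] := f01 x.
have g0 x : 0 <= g x by have /andP[] := g01 x.
apply: ge0_le_integral => //.
- by move=> x _; rewrite lee_fin mulr_ge0 ?normal_pdf_ge0.
- by apply/measurable_EFinP; apply: measurable_funM => //; exact: measurable_normal_pdf.
- by apply/measurable_EFinP; apply: measurable_funM => //; exact: measurable_normal_pdf.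
- by move=> x _; rewrite lee_fin ler_wpM2r ?normal_pdf_ge0.
Qed.

Lemma gauss_avg_itv01 m s f : measurable_fun setT f -> (forall x, 0 <= f x <= 1) ->
  0 <= gauss_avg m s f <= 1.
Proof.
move=> mf f01; apply/andP; split.
  by apply: Rintegral_ge0 => x _; have /andP[? _] := f01 x; rewrite mulr_ge0 ?normal_pdf_ge0.
apply: (@le_trans _ _ (gauss_avg m s (cst 1))).
  by apply: le_gauss_avg => // x /=; [rewrite ler01 lexx|have /andP[] := f01 x].
rewrite /gauss_avg (_ : (fun x => _) = normal_pdf m s); last first.
  by apply/funext => x; rewrite mul1r.
by rewrite /Rintegral integral_normal_pdf.
Qed.

(** Contraction in the sup norm, because the density has total mass 1. *)
Lemma gauss_avg_dist m s f g (e : R) : measurable_fun setT f -> measurable_fun setT g ->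
  (forall x, 0 <= f x <= 1) -> (forall x, 0 <= g x <= 1) ->
  (forall x, `|f x - g x| <= e) -> `|gauss_avg m s f - gauss_avg m s g| <= e.
Proof.
move=> mf mg f01 g01 fge.
have ib (h : R -> R) : measurable_fun setT h -> (forall x, 0 <= h x <= 1) ->
    mu.-integrable setT (EFin \o (fun x => h x * normal_pdf m s x)).
  move=> mh h01; apply: (@integrable_bounded_normal_pdf R m s h 1) => // x.
  by have /andP[? ?] := h01 x; rewrite ger0_norm.
have ifm := ib _ mf f01; have igm := ib _ mg g01.
rewrite /gauss_avg -RintegralB//.
have iB : mu.-integrable setT (EFin \o (fun x => f x * normal_pdf m s x - g x * normal_pdf m s x)).
  exact: (integrableB measurableT ifm igm).
apply: le_trans (le_normr_Rintegral measurableT iB) _.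
have ip : mu.-integrable setT (EFin \o (fun x => normal_pdf m s x)).
  exact: integrable_normal_pdf.
rewrite -[leRHS]mulr1.
rewrite -[X in _ <= _ * X](_ : \int[mu]_x normal_pdf m s x = 1); last first.
  by rewrite /Rintegral integral_normal_pdf.
rewrite -RintegralZl//; apply: le_Rintegral => //.
- exact: integrable_norm.
- exact: (integrableZl measurableT e ip).
- move=> x _; rewrite -mulrBl normrM (ger0_norm (normal_pdf_ge0 _ _ _)).
  by rewrite ler_wpM2r ?normal_pdf_ge0.
Qed.

(** A partial integral of a jointly measurable nonnegative function is measurable; this is what
    allows Gaussian averages to be nested. *)
Lemma measurable_gauss_avg s f : s != 0 -> measurable_fun setT f ->
  (forall x, 0 <= f x <= 1) -> measurable_fun setT (fun y => gauss_avg y s f).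
Proof.
move=> s0 mf f01.
apply/measurable_EFinP.
rewrite (_ : EFin \o _ = fubini_F mu (fun u : R * R => (f u.2 * normal_pdf u.1 s u.2)%:E)).
  apply: measurable_fun_fubini_tonelli_F.
    apply/measurable_EFinP; apply: measurable_funM; last exact: measurable_normal_pdf2.
    exact: measurableT_comp.
  by move=> u; rewrite lee_fin mulr_ge0 ?normal_pdf_ge0//; have /andP[] := f01 u.2.
by apply/funext => y; rewrite /= EFin_gauss_avg.
Qed.

(** Semigroup law. After exchanging the integrals by Tonelli, [normal_pdf_conv] isolates the
    dependence on the intermediate point y in a density of mass 1. *)
Lemma gauss_avg_comp (a b c : R) f : 0 < a -> 0 < b -> 0 < c ->
  c ^+ 2 = a ^+ 2 + b ^+ 2 -> measurable_fun setT f -> (forall x, 0 <= f x <= 1) ->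
  gauss_avg 0 a (fun y => gauss_avg y b f) = gauss_avg 0 c f.
Proof.
move=> a0 b0 c0 abc mf f01; apply: EFin_inj.
have f0 x : 0 <= f x by have /andP[] := f01 x.
have [an bn] : a != 0 /\ b != 0 by rewrite !gt_eqF.
rewrite EFin_gauss_avg; last 2 first.
- exact: measurable_gauss_avg.
- by move=> y; exact: gauss_avg_itv01.
pose h (u : R * R) := (f u.2 * normal_pdf u.1 b u.2 * normal_pdf 0 a u.1)%:E.
transitivity (\int[mu]_y \int[mu]_x h (y, x))%E.
  apply: eq_integral => y _; rewrite EFinM EFin_gauss_avg//.
  rewrite -ge0_integralZr//.
  - by apply/measurable_EFinP; apply: measurable_funM => //; exact: measurable_normal_pdf.
  - by move=> x _; rewrite lee_fin mulr_ge0 ?normal_pdf_ge0.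
  - by rewrite lee_fin normal_pdf_ge0.
rewrite fubini_tonelli; last 2 first.
- apply/measurable_EFinP; apply: measurable_funM.
    by apply: measurable_funM; [exact: measurableT_comp|exact: measurable_normal_pdf2].
  by apply: (measurableT_comp (f := normal_pdf 0 a)) => //; exact: measurable_normal_pdf.
- by move=> u; rewrite lee_fin !mulr_ge0 ?normal_pdf_ge0.
rewrite EFin_gauss_avg//; apply: eq_integral => x _.
under eq_integral => y _.
  rewrite /h/= -mulrA (normal_pdf_conv _ _ a0 b0 c0 abc) mulrA EFinM.
  over.
rewrite ge0_integralZl//.
- by rewrite integral_normal_pdf mule1.
- by apply/measurable_EFinP; exact: measurable_normal_pdf.
- by move=> y _; rewrite lee_fin normal_pdf_ge0.
- by rewrite lee_fin mulr_ge0 ?normal_pdf_ge0.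
Qed.

End gaussian_semigroup.

(** * Lindeberg replacement *)

Section lindeberg.
Context {R : realType}.
Implicit Types (f g : R -> R).

(* [a] and [b] play the roles of f' y and f'' y / 2. Stating the cubic remainder
   bound instead of differentiability makes the class visibly stable under averages
   of translates. *)
Definition smooth_test (C : R) f := [/\ continuous f, (forall x, 0 <= f x <= 1) &
  forall y, exists a b, forall h,
    `|f (y + h) - f y - a * h - b * h ^+ 2| <= C * `|h| ^+ 3].

Context {I : finType} (p x : I -> R).

Definition step_avg f y : R := \sum_i p i * f (y + x i).

Hypothesis p_ge0 : forall i, 0 <= p i.
Hypothesis p_sum1 : \sum_i p i = 1.

(** A convex combination of translates keeps the same constant [C], with the averages of the
    coefficients at the translated points as new coefficients. *)
Lemma smooth_test_step_avg C f : smooth_test C f -> smooth_test C (step_avg f).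
Proof.
move=> [cf f01 tf]; split.
- move=> y; apply: cvg_big => [|i _]; first exact: add_continuous.
  apply: cvgM; first exact: cvg_cst.
  apply: (cvg_comp (fun y => y + x i) f); last exact: cf.
  by apply: cvgD; [exact: cvg_id|exact: cvg_cst].
- move=> y; rewrite sumr_ge0 => [|i _]; last first.
    by rewrite mulr_ge0//; have /andP[] := f01 (y + x i).
  rewrite -p_sum1 ler_sum// => i _.
  by rewrite ler_piMr//; have /andP[] := f01 (y + x i).
- move=> y.
  have /choice[a /choice[b H]] := fun i => tf (y + x i).
  exists (\sum_i p i * a i), (\sum_i p i * b i) => h.
  rewrite /step_avg !mulr_suml -!sumrB.
  apply: le_trans (ler_norm_sum _ _ _) _.
  rewrite -[leRHS]mul1r -p_sum1 mulr_suml ler_sum// => i _.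
  rewrite -!mulrA -!mulrBr normrM ger0_norm// ler_wpM2l//.
  by rewrite (addrAC y h).
Qed.

Hypothesis x_mean : \sum_i p i * x i = 0.
Variable s : R.
Hypothesis s_gt0 : 0 < s.
Hypothesis x_var : \sum_i p i * x i ^+ 2 = s ^+ 2.

Let third := s ^+ 3 * std_normal_abs_moment3 + \sum_i p i * `|x i| ^+ 3.

(** Matching mean and variance make both averages equal to f y + b s^2 up to [C] times a third
    absolute moment; [third] adds the two moments. *)
Lemma step_avg_gauss_avg C f y : smooth_test C f ->
  `|step_avg f y - gauss_avg y s f| <= C * third.
Proof.
move=> [cf f01 tf]; have [a [b H]] := tf y.
have H1 := gauss_avg_taylor s_gt0 cf f01 H.
have H2 : `|step_avg f y - f y - b * s ^+ 2| <= C * \sum_i p i * `|x i| ^+ 3.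
  rewrite (_ : _ - _ - _ = \sum_i p i * (f (y + x i) - f y - a * x i - b * x i ^+ 2)).
    rewrite mulr_sumr; apply: le_trans (ler_norm_sum _ _ _) _.
    by apply: ler_sum => i _; rewrite normrM (ger0_norm (p_ge0 i)) [leRHS]mulrCA ler_wpM2l.
  have E i : p i * (f (y + x i) - f y - a * x i - b * x i ^+ 2) =
      p i * f (y + x i) - f y * p i - a * (p i * x i) - b * (p i * x i ^+ 2) by ring.
  under [RHS]eq_bigr do rewrite E.
  by rewrite !sumrB -!mulr_sumr p_sum1 x_mean x_var mulr1 mulr0 subr0.
rewrite (_ : _ - _ = (step_avg f y - f y - b * s ^+ 2) -
  (gauss_avg y s f - f y - b * s ^+ 2)); last by ring.
apply: le_trans (ler_normB _ _) _.
by rewrite /third mulrDr addrC lerD// mulrA.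
Qed.

(* The n-th power of [step_avg] is turned into the Gaussian average one factor at a
   time, from the inside, so that the difference of the two operators is only ever
   evaluated on iterates of [step_avg], which stay in the class. *)
Lemma iter_step_avg_gauss_avg C f n : (0 < n)%N -> smooth_test C f ->
  `|iter n step_avg f 0 - gauss_avg 0 (Num.sqrt n%:R * s) f| <= n%:R * (C * third).
Proof.
(* The induction starts at one step, since [gauss_avg 0 0] is not evaluation at 0. *)
elim: n f => // -[_ f _ sf|n IH f _ sf].
  by rewrite sqrtr1 !mul1r; exact: step_avg_gauss_avg.
have sAf := smooth_test_step_avg sf.
have [cf f01 _] := sf; have [cAf Af01 _] := sAf.
rewrite iterSr.
rewrite -(@gauss_avg_comp _ (Num.sqrt n.+1%:R * s) s); first last.
- by [].
- exact: continuous_measurable_fun.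
- by rewrite !exprMn !sqr_sqrtr// [in LHS]mulrSr mulrDl mul1r.
- by rewrite mulr_gt0// sqrtr_gt0 ltr0n.
- by [].
- by rewrite mulr_gt0// sqrtr_gt0 ltr0n.
apply: le_trans (ler_distD (gauss_avg 0 (Num.sqrt n.+1%:R * s) (step_avg f)) _ _) _.
rewrite [n.+2%:R]mulrSr mulrDl mul1r lerD ?IH//.
apply: gauss_avg_dist => //.
- exact: continuous_measurable_fun.
- by apply: measurable_gauss_avg; rewrite ?gt_eqF//; exact: continuous_measurable_fun.
- by move=> y; apply: gauss_avg_itv01 => //; exact: continuous_measurable_fun.
- by move=> y; exact: step_avg_gauss_avg.
Qed.

End lindeberg.

(** * A piecewise cubic step function *)

Section smooth_step.
Context {R : realType}.

Let pos3 (y : R) := Num.max 0 y ^+ 3.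

(** The positive part cubed has the Lipschitz second derivative 6 y_+, so its remainder is cubic
    even across the kink. The witnesses are the first derivative and half the second. *)
Let pos3_taylor y : exists a b, forall h : R,
  `|pos3 (y + h) - pos3 y - a * h - b * h ^+ 2| <= `|h| ^+ 3.
Proof.
exists (3 * Num.max 0 y ^+ 2), (3 * Num.max 0 y) => h.
rewrite /pos3; have [y0|y0] := leP 0 y; have [yh|yh] := leP 0 (y + h).
- by rewrite -normrX (_ : _ - _ = h ^+ 3)//; ring.
- have h0 : h < 0 by lra.
  have u3 : 0 <= (- (y + h)) ^+ 3 by rewrite exprn_ge0//; lra.
  have uh3 : (- (y + h)) ^+ 3 <= (- h) ^+ 3 by rewrite lerXn2r ?nnegrE//; lra.
  have -> : 0 ^+ 3 - y ^+ 3 - 3 * y ^+ 2 * h - 3 * y * h ^+ 2 = (- (y + h)) ^+ 3 - (- h) ^+ 3.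
    by rewrite expr0n/=; ring.
  rewrite (ltr0_norm h0) ler_norml; apply/andP; split; lra.
- have h0 : 0 < h by lra.
  rewrite (gtr0_norm h0) !expr0n/= !mulr0 !mul0r !subr0 normrX ger0_norm//.
  by rewrite lerXn2r ?nnegrE ?(ltW h0)//; lra.
- by rewrite !expr0n/= !mulr0 !mul0r !subr0 normr0 exprn_ge0.
Qed.

(* The third difference of y_+^3 / 6, that is, the distribution function of the sum
   of three independent uniform variables on [0, 1]. *)
Definition smooth_step (y : R) : R :=
  (pos3 y - 3 * pos3 (y - 1) + 3 * pos3 (y - 2) - pos3 (y - 3)) / 6.

Lemma smooth_step_le0 y : y <= 0 -> smooth_step y = 0.
Proof.
move=> y0; rewrite /smooth_step /pos3 !max_l; [|lra..].
by rewrite !expr0n/=; ring.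
Qed.

Lemma smooth_step_ge3 y : 3 <= y -> smooth_step y = 1.
Proof.
by move=> y0; rewrite /smooth_step /pos3 !max_r; [field|lra..].
Qed.

Lemma smooth_step_itv01 y : 0 <= smooth_step y <= 1.
Proof.
have [y0|y0] := leP y 0; first by rewrite smooth_step_le0// lexx ler01.
have [y3|y3] := leP 3 y; first by rewrite smooth_step_ge3// lexx ler01.
rewrite /smooth_step /pos3.
rewrite (max_r (_ : 0 <= y)) ?(max_l (_ : y - 3 <= 0)); try lra.
have cube01 (t : R) : 0 <= t <= 1 -> [/\ 0 <= t ^+ 3, t ^+ 3 <= t ^+ 2, 0 <= t ^+ 2 & t ^+ 2 <= t].
  by case/andP=> t0 t1; rewrite !exprn_ge0// !expr2 exprS expr2; split => //; nra.
have [y1|y1] := leP 0 (y - 1); have [y2|y2] := leP 0 (y - 2).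
- have : 0 <= 3 - y <= 1 by apply/andP; split; lra.
  case/cube01 => c1 c2 c3 c4.
  rewrite (_ : _ / 6 = 1 - (3 - y) ^+ 3 / 6); last by field.
  by apply/andP; split; lra.
- have : 0 <= y - 1 <= 1 by apply/andP; split; lra.
  case/cube01 => c1 c2 c3 c4.
  (* With t = y - 1 this is (t - 1)^2 (t + 2) >= 0; it supplies the upper bound 1 on the middle
     piece. *)
  have c5 : 0 <= (y - 1) ^+ 3 - 3 * (y - 1) + 2.
    rewrite (_ : _ + 2 = (y - 2) ^+ 2 * (y + 1)); last by ring.
    by rewrite mulr_ge0 ?sqr_ge0//; lra.
  rewrite (_ : _ / 6 = (1 + 3 * (y - 1) + 3 * (y - 1) ^+ 2 - 2 * (y - 1) ^+ 3) / 6); last by field.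
  by apply/andP; split; lra.
- lra.
- have : 0 <= y <= 1 by apply/andP; split; lra.
  case/cube01 => c1 c2 c3 c4.
  rewrite (_ : _ / 6 = y ^+ 3 / 6); last by field.
  by apply/andP; split; lra.
Qed.

Lemma continuous_smooth_step : continuous smooth_step.
Proof.
have cpos c : continuous (fun y => pos3 (y - c)).
  have cm : continuous ((cst 0 : R -> R^o) \max (fun y : R => y - c : R^o)).
    move=> y; apply: continuous_max; first exact: cvg_cst.
    by apply: cvgB; [exact: cvg_id|exact: cvg_cst].
  by move=> y; apply: (cvg_comp _ (fun y => y ^+ 3) (cm y)); exact: exprn_continuous.
move=> y; apply: cvgM; last exact: cvg_cst.
apply: cvgB; last exact: cpos.
apply: cvgD; last by apply: cvgM; [exact: cvg_cst|exact: cpos].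
apply: cvgB; last by apply: cvgM; [exact: cvg_cst|exact: cpos].
by have := cpos 0 y; under eq_fun do rewrite subr0.
Qed.

(** This equals 1 up to t and 0 from t + 3 e on. In the constant, 8 = 1 + 3 + 3 + 1 sums the
    absolute coefficients of the third difference, 6 is its normalisation, and e^3 comes from
    rescaling a cubic remainder. *)
Lemma smooth_test_decreasing_step (t e : R) : 0 < e ->
  smooth_test (8 / 6 / e ^+ 3) (fun y => 1 - smooth_step ((y - t) / e)).
Proof.
move=> e0; split.
- move=> y; apply: cvgB; first exact: cvg_cst.
  apply: (cvg_comp _ smooth_step); last exact: continuous_smooth_step.
  by apply: cvgM; [apply: cvgB; [exact: cvg_id|exact: cvg_cst]|exact: cvg_cst].
- move=> y; have /andP[] := smooth_step_itv01 ((y - t) / e).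
  by move=> ? ?; apply/andP; split; lra.
move=> y; set z := (y - t) / e.
have [a0 [b0 H0]] := pos3_taylor z.
have [a1 [b1 H1]] := pos3_taylor (z - 1).
have [a2 [b2 H2]] := pos3_taylor (z - 2).
have [a3 [b3 H3]] := pos3_taylor (z - 3).
exists (- (a0 - 3 * a1 + 3 * a2 - a3) / 6 / e), (- (b0 - 3 * b1 + 3 * b2 - b3) / 6 / e ^+ 2).
move=> h.
have -> : (y + h - t) / e = z + h / e by rewrite /z; ring.
have {H0}/(_ (h / e)) H0 := H0; have {H1}/(_ (h / e)) H1 := H1.
have {H2}/(_ (h / e)) H2 := H2; have {H3}/(_ (h / e)) H3 := H3.
rewrite /smooth_step.
rewrite !(addrAC z (h / e)).
have -> : 8 / 6 / e ^+ 3 * `|h| ^+ 3 = (8 / 6) * `|h / e| ^+ 3.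
  by rewrite normrM normfV (gtr0_norm e0); field; rewrite gt_eqF.
move: H0 H1 H2 H3; set w := `|h / e| ^+ 3.
have he : - (a0 - 3 * a1 + 3 * a2 - a3) / 6 / e * h = - (a0 - 3 * a1 + 3 * a2 - a3) / 6 * (h / e).
  by ring.
have he2 : - (b0 - 3 * b1 + 3 * b2 - b3) / 6 / e ^+ 2 * h ^+ 2 =
    - (b0 - 3 * b1 + 3 * b2 - b3) / 6 * (h / e) ^+ 2.
  by field; rewrite gt_eqF.
rewrite he he2; set k := h / e; set k2 := k ^+ 2.
rewrite !ler_norml => /andP[? ?] /andP[? ?] /andP[? ?] /andP[? ?].
by apply/andP; split; lra.
Qed.

End smooth_step.

(** * Central limit theorem *)

Section normal_cdf.
Context {R : realType}.
Notation mu := (@lebesgue_measure R).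

Definition normal_cdf (s t : R) : R := fine (normal_prob 0 s `]-oo, t]).

Lemma EFin_normal_cdf (s t : R) : (normal_cdf s t)%:E = normal_prob 0 s `]-oo, t].
Proof. by rewrite fineK// fin_num_measure. Qed.

Lemma gauss_avg_indic (s t : R) :
  gauss_avg 0 s \1_(`]-oo, t]) = normal_cdf s t.
Proof.
rewrite /gauss_avg /normal_cdf /Rintegral /normal_prob; congr fine.
rewrite [RHS]integral_mkcond/=; apply: eq_integral => x _.
by rewrite patchE indicE; case: ifP => _; rewrite ?mul1r ?mul0r.
Qed.

Lemma le_normal_cdf (s a b : R) : a <= b -> normal_cdf s a <= normal_cdf s b.
Proof.
move=> ab; rewrite -lee_fin !EFin_normal_cdf le_measure ?inE//.
by apply: subset_itvl; rewrite bnd_simp.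
Qed.

(** The density is at most its peak. This controls the cost of shifting a threshold by the width of
    the smoothing. *)
Lemma normal_cdf_lipschitz (s a b : R) : s != 0 -> a <= b ->
  normal_cdf s b <= normal_cdf s a + normal_peak s * (b - a).
Proof.
move=> s0 ab; rewrite -lee_fin EFinD !EFin_normal_cdf.
have -> : `]-oo, b]%classic = `]-oo, a] `|` `]a, b] :> set R.
  by rewrite -itv_bndbnd_setU// bnd_simp.
apply: le_trans (measureU2 _ _ _) _ => //; apply: leeD => //.
rewrite /normal_prob.
apply: (@le_trans _ _ (\int[mu]_(x in `]a, b]) (normal_peak s)%:E)%E).
  apply: ge0_le_integral => //.
  - by move=> x _; rewrite lee_fin normal_pdf_ge0.
  - by apply/measurable_EFinP; apply: measurable_funTS; exact: measurable_normal_pdf.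
  - by move=> x _; rewrite lee_fin normal_pdf_ub.
rewrite integral_cst//= lebesgue_measure_itv/= lte_fin.
case: ifPn => [_|_]; first by rewrite EFinM.
by rewrite mule0 lee_fin mulr_ge0 ?normal_peak_ge0 ?subr_ge0.
Qed.

End normal_cdf.

(** * Expectations of sums along independent indices *)

Section independent_indices.
Context {R : realType} {m : nat} {disp : measure_display}
  {Omega : measurableType disp} (P : probability Omega R)
  (idx : nat -> {RV P >-> 'I_m.+1}) (p : 'I_m.+1 -> R).
Hypothesis p_ge0 : forall i, 0 <= p i.
Hypothesis p_sum1 : \sum_i p i = 1.
Hypothesis idx_law : forall k i, P (idx k @^-1` [set i]) = (p i)%:E.
Hypothesis idx_indep : mutually_independent idx.

Definition cylinder (s : seq 'I_m.+1) : set Omega :=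
  [set w | forall k, (k < size s)%N -> idx k w = nth ord0 s k].

Lemma measurable_idx_preimage k (B : set 'I_m.+1) : measurable (idx k @^-1` B).
Proof. by rewrite -[X in measurable X]setTI; exact: measurable_funP. Qed.

(** Puts the event in the form to which [mutually_independent] applies. *)
Lemma cylinderE s :
  cylinder s = \bigcap_(k in [set` seq_fset tt (iota 0 (size s))])
                 (idx k @^-1` [set nth ord0 s k]).
Proof.
apply/seteqP; split=> w H k.
  by rewrite /mkset seq_fsetE mem_iota => ks; exact: H.
by move=> ks; apply: H; rewrite /mkset seq_fsetE mem_iota.
Qed.

Lemma measurable_cylinder s : measurable (cylinder s).
Proof.
rewrite cylinderE bigcap_fset; apply: bigsetI_measurable => k _.
exact: measurable_idx_preimage.
Qed.

Lemma cylinder_prob s : P (cylinder s) = (\prod_(i <- s) p i)%:E.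
Proof.
rewrite cylinderE (idx_indep _ (B := fun k => [set nth ord0 s k]))//.
rewrite (perm_big _ (seq_fset_perm _ _)) undup_id ?iota_uniq//=.
rewrite (big_nth ord0) -prodEFin /index_iota subn0.
by apply: eq_bigr => k _; exact: idx_law.
Qed.

Lemma cylinder_rcons s : cylinder s = \big[setU/set0]_(i < m.+1) cylinder (rcons s i).
Proof.
rewrite -bigcup_mkord_ord; apply/seteqP; split=> w /=.
  move=> sw; exists (idx (size s) w) => //= k.
  rewrite inord_val size_rcons ltnS nth_rcons leq_eqVlt => /predU1P[->|ks].
    by rewrite ltnn eqxx.
  by rewrite ks; exact: sw.
move=> [i _ siw] k ks; have := siw k; rewrite size_rcons ltnS ltnW// nth_rcons ks.
by apply.
Qed.

Context (x : 'I_m.+1 -> R).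

Definition partial_sum n w : R := \sum_(k < n) x (idx k w).

Lemma measurable_partial_sum n : measurable_fun setT (partial_sum n).
Proof.
apply: measurable_sum => k.
by move=> _ B _; rewrite setTI; exact: (measurable_idx_preimage k (x @^-1` B)).
Qed.

(* Conditioning on the first indices lets the induction peel off one index at a time
   without a separate independence argument for the remaining ones. *)
Lemma integral_cylinder (f : R -> R) j s :
  measurable_fun setT f -> (forall y, 0 <= f y) ->
  (\int[P]_(w in cylinder s) (f (partial_sum (size s + j) w))%:E =
   P (cylinder s) * (iter j (step_avg p x) f (\sum_(i <- s) x i))%:E)%E.
Proof.
move=> mf f0; elim: j s => [|j IH] s.
  rewrite addn0/= muleC -integral_cst; last exact: measurable_cylinder.
  apply: eq_integral => w; rewrite inE => sw; congr (f _)%:E.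
  rewrite /partial_sum (big_nth ord0) big_mkord.
  by apply: eq_bigr => k _; rewrite sw.
rewrite {1}cylinder_rcons ge0_integral_bigsetU//=; first last.
- by move=> w _; rewrite lee_fin.
- apply/measurable_EFinP; apply: measurable_funTS; apply: measurableT_comp => //.
  exact: measurable_partial_sum.
- move=> i k _ _ [w [iw kw]].
  have := iw (size s); have := kw (size s).
  by rewrite !size_rcons !nth_rcons ltnn eqxx => -> // ->.
- exact: index_enum_uniq.
- by move=> i; exact: measurable_cylinder.
rewrite cylinder_prob -EFinM [X in (_ * X)%R]/step_avg mulr_sumr -sumEFin.
apply: eq_bigr => i _.
have := IH (rcons s i); rewrite size_rcons addSnnS => ->.
by rewrite cylinder_prob -EFinM !big_rcons/= mulrA.
Qed.

(** The case of the empty word, whose cylinder is the whole space. It identifies an expectation with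
    a power of the averaging operator at 0. *)
Lemma integral_partial_sum (f : R -> R) n :
  measurable_fun setT f -> (forall y, 0 <= f y) ->
  (\int[P]_w (f (partial_sum n w))%:E = (iter n (step_avg p x) f 0)%:E)%E.
Proof.
move=> mf f0; have := integral_cylinder n [::] mf f0.
rewrite cylinder_prob !big_nil mul1e add0n => <-; congr integral.
by apply/seteqP; split.
Qed.

End independent_indices.

Lemma sqrtn_cvgy {R : realType} : Num.sqrt n%:R @[n --> \oo] --> (+oo : set_system R).
Proof.
apply/cvgryPge => A; near=> n.
apply: (le_trans (ler_norm A)); rewrite -sqrtr_sqr ler_wsqrtr//.
near: n; apply: nbhs_infty_ger.
Unshelve. all: by end_near. Qed.

(** * Convergence of the distribution functions of normalized sums *)

Section central_limit.
Context {R : realType} {m : nat} {disp : measure_display}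
  {Omega : measurableType disp} (P : probability Omega R)
  (idx : nat -> {RV P >-> 'I_m.+1}) (p : 'I_m.+1 -> R).
Hypothesis p_ge0 : forall i, 0 <= p i.
Hypothesis p_sum1 : \sum_i p i = 1.
Hypothesis idx_law : forall k i, P (idx k @^-1` [set i]) = (p i)%:E.
Hypothesis idx_indep : mutually_independent idx.
Variables (xi : 'I_m.+1 -> R) (s : R).
Hypothesis s_gt0 : 0 < s.
Hypothesis xi_mean : \sum_i p i * xi i = 0.
Hypothesis xi_var : \sum_i p i * xi i ^+ 2 = s ^+ 2.

Let third := s ^+ 3 * std_normal_abs_moment3 + \sum_i p i * `|xi i| ^+ 3.

Let third_ge0 : 0 <= third.
Proof.
rewrite addr_ge0 ?mulr_ge0 ?std_normal_abs_moment3_ge0 ?exprn_ge0 ?(ltW s_gt0)//.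
by apply: sumr_ge0 => i _; rewrite mulr_ge0// exprn_ge0.
Qed.

(** The scaling is put into the steps, so that [integral_partial_sum] applies with a step law
    depending on n. *)
Definition normalized_sum n w : R := partial_sum idx (fun i => xi i / Num.sqrt n%:R) n w.

Lemma normalized_sumE n w :
  normalized_sum n w = (\sum_(k < n) xi (idx k w)) / Num.sqrt n%:R.
Proof. by rewrite /normalized_sum /partial_sum mulr_suml. Qed.

Let measurable_normalized_sum n : measurable_fun setT (normalized_sum n).
Proof. exact: measurable_partial_sum. Qed.

Lemma measurable_normalized_sum_lt n t : measurable [set w | normalized_sum n w < t].
Proof.
have := measurable_normalized_sum n measurableT (measurable_itv `]-oo, t[).
by rewrite setTI; congr measurable; apply/seteqP; split=> w /=; rewrite in_itv.
Qed.

(** Dividing the steps by sqrt n divides the third moments by n^(3/2); the n replacements then cost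
    n^(-1/2) in total. *)
Let lindeberg_bound C f n : (0 < n)%N -> smooth_test C f ->
  (`|fine (\int[P]_w (f (normalized_sum n w))%:E)%E - gauss_avg 0 s f| <=
   C * third / Num.sqrt n%:R)%R.
Proof.
move=> n0 sf; have [cf f01 _] := sf.
have n0R : 0 < n%:R :> R by rewrite ltr0n.
have r0 : 0 < Num.sqrt n%:R :> R by rewrite sqrtr_gt0.
have rr : Num.sqrt n%:R ^+ 2 = n%:R :> R by rewrite sqr_sqrtr// ltW.
rewrite (integral_partial_sum idx_law idx_indep); last 2 first.
- exact: continuous_measurable_fun.
- by move=> y; have /andP[] := f01 y.
have m0 : \sum_i p i * (xi i / Num.sqrt n%:R) = 0.
  by under eq_bigr do rewrite mulrA; rewrite -mulr_suml xi_mean mul0r.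
have v0 : \sum_i p i * (xi i / Num.sqrt n%:R) ^+ 2 = (s / Num.sqrt n%:R) ^+ 2.
  by under eq_bigr do rewrite exprMn mulrA; rewrite -mulr_suml xi_var -exprMn.
have := iter_step_avg_gauss_avg p_ge0 p_sum1 m0 (divr_gt0 s_gt0 r0) v0 n0 sf.
rewrite mulrCA divff ?gt_eqF// mulr1 => /le_trans; apply.
have -> : \sum_i p i * `|xi i / Num.sqrt n%:R| ^+ 3 =
    (\sum_i p i * `|xi i| ^+ 3) / Num.sqrt n%:R ^+ 3.
  rewrite mulr_suml; apply: eq_bigr => i _.
  by rewrite normrM normfV (gtr0_norm r0) exprMn exprVn mulrA.
set r := Num.sqrt n%:R in rr r0 *.
rewrite -rr /third le_eqVlt; apply/orP; left; apply/eqP; field.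
by rewrite gt_eqF.
Qed.

Let F := normal_cdf s.
Let G n t := fine (P [set w | normalized_sum n w < t]).

Let EFin_G n t : (G n t)%:E = P [set w | normalized_sum n w < t].
Proof. by rewrite fineK// fin_num_measure//; exact: measurable_normalized_sum_lt. Qed.

(** The indicator of ]-oo, t[ lies between the smooth steps descending on [t - 3 e, t] and on
    [t, t + 3 e]. The error is uniform in t, which later permits moving thresholds. *)
Let step_bound n (t e : R) : (0 < n)%N -> 0 < e ->
  F (t - 3 * e) - 8 / 6 / e ^+ 3 * third / Num.sqrt n%:R <= G n t /\
  G n t <= F (t + 3 * e) + 8 / 6 / e ^+ 3 * third / Num.sqrt n%:R.
Proof.
move=> n0 e0.
pose q (a y : R) := 1 - smooth_step ((y - a) / e).
have sq a : smooth_test (8 / 6 / e ^+ 3) (q a) by exact: smooth_test_decreasing_step.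
have mq a : measurable_fun setT (q a).
  by have [cq _ _] := sq a; exact: continuous_measurable_fun.
have q01 a y : 0 <= q a y <= 1 by have [] := sq a.
have qle a y : y <= a -> q a y = 1.
  move=> ya; rewrite /q smooth_step_le0 ?subr0//.
  by rewrite pmulr_lle0 ?invr_gt0// subr_le0.
have qge a y : a + 3 * e <= y -> q a y = 0.
  move=> ya; rewrite /q smooth_step_ge3 ?subrr//.
  by rewrite ler_pdivlMr// lerBrDl.
have mind a : measurable_fun setT (\1_(`]-oo, a]) : R -> R) by exact: measurable_indic.
have ind01 a (y : R) : 0 <= (\1_(`]-oo, a]) : R -> R) y <= 1.
  by rewrite indicE; case: (_ \in _); rewrite /= ?lexx ler01.
have itvP (a y : R) : (y \in (`]-oo, a]%classic : set R)) = (y <= a).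
  by apply/idP/idP; rewrite inE/= in_itv.
have GE : (G n t)%:E = (\int[P]_w (\1_[set w | normalized_sum n w < t] w)%:E)%E.
  by rewrite EFin_G integral_indic ?setIT//; exact: measurable_normalized_sum_lt.
have intq a : (fine (\int[P]_w (q a (normalized_sum n w))%:E)%E)%:E =
    (\int[P]_w (q a (normalized_sum n w))%:E)%E.
  rewrite (integral_partial_sum idx_law idx_indep)//.
  by move=> y; have /andP[] := q01 a y.
have mqS a : measurable_fun setT (fun w => (q a (normalized_sum n w))%:E).
  by apply/measurable_EFinP; exact: measurableT_comp.
have mindS : measurable_fun setT (fun w => (\1_[set w | normalized_sum n w < t] w)%:E : \bar R).
  by apply/measurable_EFinP; apply: measurable_indic; exact: measurable_normalized_sum_lt.
split.
- have := lindeberg_bound n0 (sq (t - 3 * e)).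
  rewrite ler_norml => /andP[H _].
  have H1 : F (t - 3 * e) <= gauss_avg 0 s (q (t - 3 * e)).
    rewrite /F -gauss_avg_indic; apply: le_gauss_avg => // y.
    rewrite indicE itvP; have [yt|_] := leP y (t - 3 * e); first by rewrite qle.
    by have /andP[] := q01 (t - 3 * e) y.
  have H2 : fine (\int[P]_w (q (t - 3 * e) (normalized_sum n w))%:E)%E <= G n t.
    rewrite -lee_fin intq GE; apply: ge0_le_integral => //.
    + by move=> w _; rewrite lee_fin; have /andP[] := q01 (t - 3 * e) (normalized_sum n w).
    + move=> w _; rewrite lee_fin indicE.
      have [wt|wt] := ltP (normalized_sum n w) t.
        by rewrite mem_set//; have /andP[] := q01 (t - 3 * e) (normalized_sum n w).
      by rewrite qge ?subrK.
  by lra.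
- have := lindeberg_bound n0 (sq t).
  rewrite ler_norml => /andP[_ H].
  have H1 : gauss_avg 0 s (q t) <= F (t + 3 * e).
    rewrite /F -gauss_avg_indic; apply: le_gauss_avg => // y.
    rewrite indicE itvP; have [_|yt] := leP y (t + 3 * e); first by have /andP[] := q01 t y.
    by rewrite qge// ltW.
  have H2 : G n t <= fine (\int[P]_w (q t (normalized_sum n w))%:E)%E.
    rewrite -lee_fin intq GE; apply: ge0_le_integral => //.
    move=> w _; rewrite lee_fin indicE.
    have [wt|wt] := ltP (normalized_sum n w) t.
      by rewrite qle ?(ltW wt)// lern1 leq_b1.
    rewrite memNset; first by have /andP[] := q01 t (normalized_sum n w).
    by move=> /=; apply/negP; rewrite -leNgt.
  by lra.
Qed.

Lemma normalized_sum_cvg (t_ : nat -> R) t : t_ @ \oo --> t ->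
  P [set w | normalized_sum n w < t_ n] @[n --> \oo] --> normal_prob 0 s `]-oo, t].
Proof.
move=> tt.
rewrite -EFin_normal_cdf.
under eq_fun do rewrite -EFin_G.
apply: cvg_EFin; first by apply: nearW.
rewrite /comp/=; apply/cvgrPdist_le => /= eps eps0.
have pk := normal_peak_gt0 (lt0r_neq0 s_gt0).
(* The threshold moves by at most 4 d: 3 d from the smoothing and d from [t_ n]. This choice makes
   the resulting change of the normal distribution function at most eps / 2, and the Lindeberg error
   takes the other half. *)
pose d := eps / (8 * normal_peak s).
have d0 : 0 < d by rewrite divr_gt0// mulr_gt0.
have pd : normal_peak s * d = eps / 8 by rewrite /d; field; rewrite gt_eqF.
pose K := 8 / 6 / d ^+ 3 * third.
have K0 : 0 <= K by rewrite /K !mulr_ge0// invr_ge0 exprn_ge0// ltW.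
near=> n.
have n0 : (0 < n)%N by near: n; exact: nbhs_infty_gt.
have r0 : 0 < Num.sqrt n%:R :> R by rewrite sqrtr_gt0 ltr0n.
have Kn : K / Num.sqrt n%:R <= eps / 2.
  rewrite ler_pdivrMr// -ler_pdivrMl ?divr_gt0//.
  near: n; exact: (cvgry_ge sqrtn_cvgy).
have tn : `|t - t_ n| <= d.
  by near: n; move/cvgrPdist_le : tt; apply.
have [L U] := step_bound (t_ n) n0 d0.
move: tn; rewrite ler_norml => /andP[tn1 tn2].
have U1 : F (t_ n + 3 * d) <= F t + normal_peak s * (4 * d).
  apply: (@le_trans _ _ (F (t + 4 * d))); first by apply: le_normal_cdf; lra.
  have := @normal_cdf_lipschitz R s t (t + 4 * d) (lt0r_neq0 s_gt0).
  by rewrite (_ : t + 4 * d - t = 4 * d); [apply; lra|ring].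
have L1 : F t <= F (t_ n - 3 * d) + normal_peak s * (4 * d).
  have := @normal_cdf_lipschitz R s (t - 4 * d) t (lt0r_neq0 s_gt0).
  rewrite (_ : t - (t - 4 * d) = 4 * d); last by ring.
  move=> H; apply: (le_trans (H _)); first by lra.
  by rewrite lerD2r; apply: le_normal_cdf; lra.
have pd4 : normal_peak s * (4 * d) = eps / 2 by rewrite mulrCA pd; field.
rewrite pd4 in U1 L1; rewrite -/K in L U.
by rewrite ler_norml /F -/(G n (t_ n)); apply/andP; split; rewrite /F in L U L1 U1; lra.
Unshelve. all: by end_near. Qed.

End central_limit.

(** * Convergence in distribution from distribution functions *)

Section weak_convergence.
Context {R : realType} {disp : measure_display}
  {Omega : measurableType disp} (P : probability Omega R)
  (X : nat -> {RV P >-> R}) (nu : probability (measurableTypeR R) R).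

(** Measurability and boundedness are bundled in, so that the class is closed under linear
    combinations without side conditions. *)
Definition expectation_cvg (h : R -> R) := [/\ measurable_fun setT h,
  exists M, forall x, `|h x| <= M &
  \int[P]_w h (X n w) @[n --> \oo] --> \int[nu]_x h x].

Lemma bounded_integrable d (T : measurableType d) (Q : probability T R) (h : T -> R) (M : R) :
  measurable_fun setT h -> (forall x, `|h x| <= M) ->
  Q.-integrable setT (EFin \o h).
Proof.
move=> mh hM; apply: measurable_bounded_integrable => //.
  by rewrite (le_lt_trans (probability_le1 _ _)) ?ltry.
by exists M; split; [exact: num_real|move=> y My x _; exact: le_trans (hM x) (ltW My)].
Qed.

Let iX (h : R -> R) (M : R) n : measurable_fun setT h -> (forall x, `|h x| <= M) ->
  P.-integrable setT (EFin \o (fun w => h (X n w))).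
Proof.
move=> mh hM; apply: (@bounded_integrable _ _ _ _ M) => [|w]; last exact: hM.
by apply: (measurableT_comp (f := h)).
Qed.

Lemma expectation_cvgD g h : expectation_cvg g -> expectation_cvg h ->
  expectation_cvg (fun x => g x + h x).
Proof.
move=> [mg [M gM] cg] [mh [N hN] ch]; split.
- exact: measurable_funD.
- by exists (M + N) => x; apply: le_trans (ler_normD _ _) _; exact: lerD.
- rewrite RintegralD//; last 2 first.
  + exact: (@bounded_integrable _ _ nu g M mg gM).
  + exact: (@bounded_integrable _ _ nu h N mh hN).
  under eq_fun do (rewrite RintegralD//; [|exact: (iX _ mg gM)|exact: (iX _ mh hN)]).
  exact: cvgD.
Qed.

Lemma expectation_cvgZ (k : R) h : expectation_cvg h ->
  expectation_cvg (fun x => k * h x).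
Proof.
move=> [mh [N hN] ch]; split.
- exact: measurable_funM.
- by exists (`|k| * N) => x; rewrite normrM ler_wpM2l.
- rewrite RintegralZl//; last exact: (@bounded_integrable _ _ nu h N mh hN).
  under eq_fun do (rewrite RintegralZl//; last exact: (iX _ mh hN)).
  by apply: cvgM; first exact: cvg_cst.
Qed.

Lemma expectation_cvg_cst (k : R) : expectation_cvg (cst k).
Proof.
split => //; first by exists `|k|.
rewrite Rintegral_cst//.
under eq_fun do rewrite Rintegral_cst//.
by rewrite /= !probability_setT; exact: cvg_cst.
Qed.

(** The error control [r] lies in the class too, so its small integral under [nu] carries over to
    the laws of [X n]. The budget is e/4 for h - g under [nu], e/4 for [g], and e/2 for h - g under
    [P]. *)
Lemma expectation_cvg_approx (h : R -> R) : measurable_fun setT h ->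
  (exists M : R, forall x, `|h x| <= M) ->
  (forall e : R, 0 < e -> exists g r, [/\ expectation_cvg g, expectation_cvg r,
     (forall x, `|h x - g x| <= r x) & \int[nu]_x r x <= e]) ->
  expectation_cvg h.
Proof.
move=> mh [M hM] H; split => //; first by exists M.
apply/cvgrPdist_le => /= e e0.
have [g [r [[mg [N gN] cg] [mr [K rK] cr] hgr re]]] := H (e / 4) ltac:(by rewrite divr_gt0).
have dist d (T : measurableType d) (Q : probability T R) (Y : T -> R) :
    measurable_fun setT Y ->
    `|\int[Q]_w h (Y w) - \int[Q]_w g (Y w)| <= \int[Q]_w r (Y w).
  move=> mY.
  have iY (k : R -> R) L : measurable_fun setT k -> (forall x, `|k x| <= L) ->
      Q.-integrable setT (EFin \o (fun w => k (Y w))).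
    move=> mk kL; apply: (@bounded_integrable _ _ _ _ L) => [|w]; last exact: kL.
    exact: (measurableT_comp (f := k)).
  have ih := iY _ _ mh hM; have ig := iY _ _ mg gN; have ir := iY _ _ mr rK.
  rewrite -RintegralB//.
  have iB : Q.-integrable setT (EFin \o (fun w => h (Y w) - g (Y w))).
    exact: (integrableB measurableT ih ig).
  apply: le_trans (le_normr_Rintegral measurableT iB) _.
  by apply: le_Rintegral => //; exact: integrable_norm.
have nu1 := dist _ _ nu id (@measurable_id _ _ _).
near=> n.
have P1 := dist _ _ P (X n) (@measurable_funPT _ _ _ _ (X n)).
have G1 : `|\int[nu]_x g x - \int[P]_w g (X n w)| <= e / 4.
  by near: n; move/cvgrPdist_le : cg; apply; rewrite divr_gt0.
have R1 : `|\int[nu]_x r x - \int[P]_w r (X n w)| <= e / 4.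
  by near: n; move/cvgrPdist_le : cr; apply; rewrite divr_gt0.
move: nu1 P1 G1 R1 re; rewrite /= !ler_norml.
move=> /andP[? ?] /andP[? ?] /andP[? ?] /andP[? ?] ?.
by apply/andP; split; lra.
Unshelve. all: by end_near. Qed.

Hypothesis cdf_cvg : forall t : R,
  P [set w | X n w < t] @[n --> \oo] --> nu `]-oo, t[%classic.

Lemma expectation_cvg_indic (t : R) : expectation_cvg (\1_(`]-oo, t[)).
Proof.
have mi : measurable_fun setT (\1_(`]-oo, t[) : R -> R) by exact: measurable_indic.
split => //.
  by exists 1 => x; rewrite indicE; case: (_ \in _); rewrite /= ?normr1 ?normr0.
have -> : \int[nu]_x (\1_(`]-oo, t[%classic) : R -> R) x = fine (nu `]-oo, t[%classic).
  by rewrite /Rintegral integral_indic ?setIT.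
have mX n : measurable [set w | X n w < t].
  rewrite (_ : mkset _ = X n @^-1` `]-oo, t[); last first.
    by apply/seteqP; split => w /=; rewrite in_itv.
  by rewrite -[Y in measurable Y]setTI; exact: measurable_funP.
have E n : \int[P]_w (\1_(`]-oo, t[%classic) : R -> R) (X n w) = fine (P [set w | X n w < t]).
  rewrite /Rintegral; congr fine.
  transitivity (\int[P]_w (\1_[set w | X n w < t] w)%:E)%E; last first.
    by rewrite integral_indic ?setIT.
  apply: eq_integral => w _; rewrite !indicE.
  have [xt|xt] := ltP (X n w) t; first by rewrite !mem_set//= in_itv.
  by rewrite !memNset//= ?in_itv/=; apply/negP; rewrite -leNgt.
under eq_fun do rewrite E.
by apply: fine_cvg; rewrite fineK ?fin_num_measure//; exact: cdf_cvg.
Qed.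

(** A difference of two half-lines. Half-open intervals concatenate without overlap, and all
    endpoints are available because [cdf_cvg] holds at every t. *)
Lemma expectation_cvg_itv (a b : R) : a <= b -> expectation_cvg (\1_(`[a, b[)).
Proof.
move=> ab.
rewrite (_ : \1_(_) = fun x : R => \1_(`]-oo, b[) x + -1 * (\1_(`]-oo, a[) x : R)).
  by apply: expectation_cvgD; [|apply: expectation_cvgZ]; exact: expectation_cvg_indic.
apply/funext => x; rewrite !indicE.
have itvP (i : interval R) : (x \in [set` i]%classic) = (x \in i).
  by apply/idP/idP; [move/set_mem|move=> xi; exact/mem_set].
rewrite !itvP !in_itv/=.
have [xa|xa] := ltP x a; have [xb|xb] := ltP x b; rewrite /=; try ring.
by have := lt_le_trans xa (le_trans ab xb); rewrite ltxx.
Qed.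

(** Vanishing outside the interval lets adjacent approximants be glued by addition. *)
Let step_on (f : R -> R) (e a b : R) := a <= b /\ exists g, [/\ expectation_cvg g,
  (forall x, a <= x < b -> `|f x - g x| <= e) & (forall x, ~~ (a <= x < b) -> g x = 0)].

Let step_on_trans f e a b c : step_on f e a b -> step_on f e b c -> step_on f e a c.
Proof.
move=> [ab [g [cg g1 g2]]] [bc [h [ch h1 h2]]]; split; first exact: le_trans bc.
exists (fun x => g x + h x); split; first exact: expectation_cvgD.
- move=> x /andP[ax xc]; have [xb|bx] := ltP x b.
    by rewrite h2 ?addr0 ?g1 ?ax// leNgt xb.
  by rewrite g2 ?add0r ?h1 ?bx// ltNge bx andbF.
- move=> x xac; rewrite g2 ?h2 ?addr0//.
    by apply: contra xac => /andP[bx ->]; rewrite (le_trans ab bx).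
  by apply: contra xac => /andP[-> xb]; rewrite (lt_le_trans xb bc).
Qed.

(** By continuity the constant f c times an indicator suffices near c. The empty interval a = b is
    included and starts the creeping argument below. *)
Let step_on_local (f : R -> R) (e c : R) : continuous f -> 0 < e ->
  exists2 d, 0 < d & forall a b, c - d < a -> a <= b -> b < c + d -> step_on f e a b.
Proof.
move=> cf e0.
have /cvgrPdist_lt/(_ e e0) := cf c.
move/nbhs_ballP => [d /= d0 H]; exists d => // a b ca ab bc; split => //.
exists (fun x => f c * \1_(`[a, b[) x); split.
- by apply: expectation_cvgZ; exact: expectation_cvg_itv.
- move=> x axb; rewrite indicE mem_set; last by rewrite /= in_itv.
  rewrite mulr1 distrC ltW//; apply: H; rewrite /ball/= distrC ltr_distl.
  by move/andP: axb => [? ?]; apply/andP; split; lra.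
- by move=> x axb; rewrite indicE memNset ?mulr0//= in_itv/=; exact/negP.
Qed.

(* Creeping along [a, b]: the supremum of the reachable points is reachable and
   cannot be smaller than b. *)
Let step_on_itv (f : R -> R) (e a b : R) : continuous f -> 0 < e -> a <= b -> step_on f e a b.
Proof.
move=> cf e0 ab.
pose S := [set c | c <= b /\ step_on f e a c].
have Sa : S a.
  split => //; have [d d0 H] := step_on_local a cf e0.
  by apply: H => //; lra.
have hS : has_sup S by split; [exists a|exists b => c []].
set c := sup S.
have ac : a <= c by apply: ub_le_sup => //; case: hS.
have cb : c <= b by apply: ge_sup => [|x []//]; exists a.
have [d d0 H] := step_on_local c cf e0.
have [c' [c'b sc'] cc'] : exists2 c', S c' & c - d < c' by apply: sup_adherent.
have c'c : c' <= c by apply: ub_le_sup; [case: hS|split].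
have [cdb|bcd] := ltP b (c + d).
  apply: (step_on_trans sc'); apply: H => //.
have : S (c + d / 2).
  split; first by lra.
  by apply: (step_on_trans sc'); apply: H => //; lra.
move=> /(ub_le_sup (proj2 hS)); rewrite -/c => ?.
exfalso; lra.
Qed.

Lemma cvg_in_distribution_cdf : cvg_in_distribution X nu.
Proof.
move=> f cf [M0 [_ fM0]].
(* [bounded_fun] only provides the bounds strictly above [M0]. *)
pose M := `|M0| + 1.
have fM x : `|f x| <= M by apply: fM0 => //; rewrite /M (le_lt_trans (ler_norm M0))// ltrDl.
have mf : measurable_fun setT f by exact: continuous_measurable_fun.
suff [_ _ H] : expectation_cvg f.
  rewrite -(fineK (integrable_fin_num _ (bounded_integrable nu mf fM)))//.
  under eq_fun do rewrite unlock -(fineK (integrable_fin_num _ (iX _ mf fM)))//.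
  by apply: cvg_EFin; [exact: nearW|exact: H].
apply: expectation_cvg_approx => //; first by exists M.
move=> e e0.
have M0' : 0 < M by rewrite /M ltr_wpDl.
pose d := e / (4 * M).
have d0 : 0 < d by rewrite divr_gt0// mulr_gt0.
pose T n : set R := `[- n%:R, n%:R[%classic.
have /fine_cvgP[_ /cvgrPdist_le/(_ d d0) Tcvg] : nu (T n) @[n --> \oo] --> (1%E : \bar R).
  have -> : 1%E = nu (\bigcup_n T n).
    rewrite (_ : \bigcup_n T n = setT) ?probability_setT// -subTset => x _.
    exists (Num.truncn `|x|).+1 => //=; rewrite /T/= in_itv/=.
    have := truncnS_gt `|x|; rewrite ltr_norml => /andP[/ltW -> ->].
    by [].
  apply: nondecreasing_cvg_mu => //.
  - by move=> n; exact: measurable_itv.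
  - by apply: bigcup_measurable => n _; exact: measurable_itv.
  - move=> n k nk; apply/subsetPset => x; rewrite /T/= !in_itv/= => /andP[nx xn].
    have nkR : n%:R <= k%:R :> R by rewrite ler_nat.
    by apply/andP; split; lra.
have [n nd] : exists n, `|1 - fine (nu (T n))| <= d.
  by near \oo => n; exists n; near: n; exact: Tcvg.
have nn : - n%:R <= n%:R :> R by rewrite lerNl -subr_ge0 opprK addr_ge0.
have [_ [g [cg g1 g2]]] := step_on_itv cf (divr_gt0 e0 (ltr0Sn R 1)) nn.
(* Equal to e/2 on the window, where [g] is that close to [f], and to e/2 + M outside, where [g]
   vanishes. The mass outside is at most e / (4 M), so the integral is at most 3 e / 4. *)
pose r (x : R) : R := (e / 2 + M) + - M * \1_(`[- n%:R, n%:R[) x.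
have cr : expectation_cvg r.
  apply: expectation_cvgD; first exact: expectation_cvg_cst.
  by apply: expectation_cvgZ; exact: expectation_cvg_itv.
exists g, r; split => //.
- move=> x; rewrite /r indicE.
  rewrite (_ : (x \in _) = (- n%:R <= x < n%:R)); last by apply/idP/idP; rewrite inE/= in_itv.
  have [xn|xn] := boolP (- n%:R <= x < n%:R); rewrite /=.
    by rewrite mulr1 addrK g1.
  by rewrite g2// mulr0 addr0 subr0 ler_wpDl// divr_ge0// ltW.
- have mi : measurable_fun setT (\1_(T n) : R -> R).
    by apply: measurable_indic; exact: measurable_itv.
  have i1 (x : R) : `|\1_(T n) x : R| <= 1.
    by rewrite indicE; case: (_ \in _); rewrite /= ?normr1 ?normr0.
  have ii : nu.-integrable setT (EFin \o (\1_(T n) : R -> R)).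
    exact: (@bounded_integrable _ _ nu _ 1 mi i1).
  rewrite /r RintegralD//; last 2 first.
    exact: (@bounded_integrable _ _ nu (cst (e / 2 + M)) `|e / 2 + M|).
    exact: (integrableZl measurableT _ ii).
  rewrite RintegralZl// Rintegral_cst//= probability_setT mulr1.
  rewrite {1}/Rintegral integral_indic ?setIT//.
  have dM : d * M = e / 4 by rewrite /d; field; rewrite gt_eqF.
  move: nd; rewrite ler_norml => /andP[_ nd].
  have := ler_wpM2r (ltW M0') nd; rewrite dM /T.
  lra.
Unshelve. all: by end_near. Qed.

End weak_convergence.

(** * Diagonal products and the delta method *)

Section diagonal_products.
Context {R : realType}.
Local Notation normc := (@Normc.normc R).

Lemma normc_ge0 (z : R[i]) : 0 <= normc z.
Proof. by case: z => a b; exact: sqrtr_ge0. Qed.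

Lemma normc_gt0 (z : R[i]) : z != 0 -> 0 < normc z.
Proof.
move=> z0; rewrite lt_neqAle normc_ge0 andbT eq_sym; apply: contra z0 => /eqP.
by move/Normc.eq0_normc => ->.
Qed.

Lemma normc_prod n (z : 'I_n -> R[i]) :
  normc (\prod_(k < n) z k) = \prod_(k < n) normc (z k).
Proof. exact: (big_morph normc (@Normc.normcM R) (@Normc.normc1 R)). Qed.

(** Any nonzero coordinate j of a row eigenvector forces z to be the j-th entry; conversely the unit
    rows are eigenvectors. *)
Lemma eigenvalue_diag_mx (F : fieldType) d (v : 'rV[F]_d) z :
  reflect (exists j, z = v ord0 j) (eigenvalue (diag_mx v) z).
Proof.
apply: (iffP eigenvalueP) => [[u uv u0]|[j ->]].
  have /rV0Pn[j uj] := u0; exists j.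
  move/rowP/(_ j): uv; rewrite mul_mx_diag !mxE mulrC => /(mulIf uj) ->.
  by [].
exists (delta_mx 0 j).
  by apply/rowP => k; rewrite mul_mx_diag !mxE/= mulrC;
    case: eqP => [->|_]; rewrite ?mulr1// !mulr0.
by apply/rV0Pn; exists j; rewrite mxE !eqxx oner_neq0.
Qed.

Lemma spectral_radius_diag_mx d (v : 'rV[R[i]]_d.+1) :
  (forall j, normc (v ord0 j) <= normc (v ord0 ord0)) ->
  spectral_radius (diag_mx v) = normc (v ord0 ord0).
Proof.
move=> vmax; rewrite /spectral_radius.
set S := [set _ | _ in _].
have ubS : ubound S (normc (v ord0 ord0)).
  by move=> _ [z /eigenvalue_diag_mx[j ->] <-].
have S0 : S (normc (v ord0 ord0)).
  by exists (v ord0 ord0) => //; apply/eigenvalue_diag_mx; exists ord0.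
apply/eqP; rewrite eq_le ge_sup//=; last by exists (normc (v ord0 ord0)).
by apply: ub_le_sup => //; exists (normc (v ord0 ord0)).
Qed.

Context {m d : nat} {disp : measure_display} {Omega : measurableType disp}
  {P : probability Omega R} (lam : 'I_m.+1 -> 'rV[R[i]]_d.+1)
  (idx : nat -> {RV P >-> 'I_m.+1}).

Lemma random_product_diag_mx n w :
  random_product (fun i => diag_mx (lam i)) idx n w =
  diag_mx (\row_j \prod_(k < n) lam (idx k w) ord0 j).
Proof.
elim: n => [|n IH] /=.
  rewrite -diag_const_mx; congr diag_mx; apply/rowP => j.
  by rewrite !mxE big_ord0.
rewrite IH mulmx_diag; congr diag_mx; apply/rowP => j.
by rewrite !mxE big_ord_recr/= mulrC.
Qed.

Hypothesis lam_neq0 : forall i j, lam i ord0 j != 0.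
Hypothesis lam_dominant : forall i j, normc (lam i ord0 j) <= normc (lam i ord0 ord0).

(** Dominance of the first entry in each factor passes to the product, whose logarithm is then a
    sum. At n = 0 both sides are 1, as the inverse of 0 is 0. *)
Lemma random_spectral_radius_expR n w :
  random_spectral_radius (fun i => diag_mx (lam i)) idx n w =
  expR ((\sum_(k < n) ln (normc (lam (idx k w) ord0 ord0))) / n%:R).
Proof.
rewrite /random_spectral_radius random_product_diag_mx spectral_radius_diag_mx; last first.
  move=> j; rewrite !mxE !normc_prod; apply: ler_prod => k _.
  by rewrite normc_ge0 lam_dominant.
rewrite mxE normc_prod expRM expR_sum; congr (_ `^ _).
by apply: eq_bigr => k _; rewrite lnK// posrE normc_gt0.
Qed.

Lemma asymptotic_spectral_radius_expR (p : 'I_m.+1 -> R) :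
  asymptotic_spectral_radius p lam =
  expR (\sum_i p i * ln (normc (lam i ord0 ord0))).
Proof.
rewrite /asymptotic_spectral_radius expR_sum; apply: eq_bigr => i _.
by rewrite mulrC expRM lnK// posrE normc_gt0.
Qed.

End diagonal_products.

(** * Mean and variance of a finitely supported law *)

Section discrete_law.
Context {R : realType} {m : nat} (p L : 'I_m.+1 -> R).
Hypothesis p_ge0 : forall i, 0 <= p i.
Context {disp : measure_display} {Omega : measurableType disp}
  (P : probability Omega R) (Z : {RV P >-> R}).
Hypothesis Z_law : forall B : set R, measurable B ->
  distribution P Z B = (\sum_(i < m.+1) (p i)%:E * \d_(L i) B)%E.

Lemma ge0_integral_discrete (h : R -> R) : measurable_fun setT h -> (forall x, 0 <= h x) ->
  (\int[P]_w (h (Z w))%:E = (\sum_i p i * h (L i))%:E)%E.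
Proof.
move=> mh h0.
(* [msum] sums a sequence of measures, hence the indexing by natural numbers through [inord]. *)
pose mm (k : nat) := mscale (NngNum (p_ge0 (inord k))) (dirac (L (inord k)) : measure _ R).
rewrite -(@ge0_integral_distribution _ _ _ _ _ P Z (EFin \o h)); last 2 first.
- exact/measurable_EFinP.
- by move=> y; rewrite lee_fin.
rewrite (@eq_measure_integral _ _ _ _ (msum (fun k => mm k : measure _ _) m.+1)); last first.
  move=> A mA _; rewrite [LHS]Z_law//= /msum; apply: eq_bigr => i _.
  by rewrite /mm /mscale/= inord_val.
rewrite ge0_integral_measure_sum//; last 2 first.
- by move=> x _; rewrite lee_fin.
- exact/measurable_EFinP.
rewrite -sumEFin; apply: eq_bigr => i _.
rewrite ge0_integral_mscale//; last 2 first.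
- exact/measurable_EFinP.
- by move=> x _; rewrite lee_fin.
rewrite integral_dirac//; last exact/measurable_EFinP.
by rewrite diracT mul1e /= inord_val.
Qed.

(** The positive and negative parts are treated separately by [ge0_integral_discrete] and recombined
    through max (L, 0) - max (- L, 0) = L. *)
Lemma expectation_discrete : ('E_P[Z] = (\sum_i p i * L i)%:E)%E.
Proof.
rewrite expectation_def integralE.
have -> : (\int[P]_w (fun w => (Z w)%:E)^\+ w = (\sum_i p i * Num.max (L i) 0)%:E)%E.
  rewrite -(ge0_integral_discrete (h := fun x => Num.max x 0)).
  - by apply: eq_integral => w _; rewrite funeposE -EFin_max.
  - exact: measurable_maxr.
  - by move=> x; rewrite le_max lexx orbT.
have -> : (\int[P]_w (fun w => (Z w)%:E)^\- w = (\sum_i p i * Num.max (- L i) 0)%:E)%E.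
  rewrite -(ge0_integral_discrete (h := fun x => Num.max (- x) 0)).
  - by apply: eq_integral => w _; rewrite funenegE -EFin_max.
  - by apply: measurable_maxr => //; exact: oppr_measurable.
  - by move=> x; rewrite le_max lexx orbT.
rewrite -EFinB -sumrB; congr (_%:E); apply: eq_bigr => i _.
rewrite -mulrBr; congr (_ * _); rewrite /Num.max oppr_lt0.
by case: ltgtP => [| |->]; rewrite ?subr0 ?sub0r ?opprK.
Qed.

Lemma variance_discrete :
  ('V_P[Z] = (\sum_i p i * (L i - \sum_j p j * L j) ^+ 2)%:E)%E.
Proof.
rewrite /variance unlock expectation_discrete /=.
rewrite -(ge0_integral_discrete (h := fun x => (x - \sum_j p j * L j) ^+ 2)).
- by rewrite unlock; apply: eq_integral => w _.
- by apply: measurable_funX; exact: measurable_funB.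
- by move=> x; exact: sqr_ge0.
Qed.

End discrete_law.

(** * Logarithmic thresholds and the fluctuations of the spectral radius *)

Section delta_method.
Context {R : realType}.

(** The bound ln (1 + v) <= v, used at u and at - u / (1 + u), puts the difference between 0 and u^2
    / (1 + u), where 1 + u >= 1/2. *)
Lemma ln1D_dist (u : R) : - 2^-1 <= u -> `|u - ln (1 + u)| <= 2 * u ^+ 2.
Proof.
move=> u2.
have u1 : 0 < 1 + u by lra.
have H1 : ln (1 + u) <= u by apply: le_ln1Dx; lra.
have H2 : ln ((1 + u)^-1) <= - u / (1 + u).
  have := @le_ln1Dx R (- u / (1 + u)).
  have -> : 1 + - u / (1 + u) = (1 + u)^-1 by field; rewrite gt_eqF.
  apply; rewrite ltr_pdivlMr//; lra.
rewrite lnV ?posrE// in H2.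
rewrite ger0_norm ?subr_ge0//.
apply: (@le_trans _ _ (u - u / (1 + u))); first by rewrite mulNr in H2; lra.
rewrite (_ : u - _ = u ^+ 2 / (1 + u)); last by field; rewrite gt_eqF.
rewrite ler_pdivrMr//.
have := sqr_ge0 u; nra.
Qed.

(** With r = k sqrt n and u = t / r, [ln1D_dist] bounds the error by 2 t^2 / r. Of the two lower
    bounds on r, [r1] ensures u >= - 1/2 and [r2] makes this error at most e. *)
Lemma cvg_ln_threshold (k t : R) : 0 < k ->
  k * Num.sqrt n%:R * ln (1 + t / (k * Num.sqrt n%:R)) @[n --> \oo] --> t.
Proof.
move=> k0; apply/cvgrPdist_le => /= e e0.
near=> n.
have r0 : 0 < Num.sqrt n%:R :> R.
  by near: n; exact: (cvgry_gt sqrtn_cvgy).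
set r := k * Num.sqrt n%:R.
have rp : 0 < r by rewrite mulr_gt0.
have r1 : 2 * `|t| <= r.
  rewrite /r -ler_pdivrMl//; near: n; exact: (cvgry_ge sqrtn_cvgy).
have r2 : 2 * t ^+ 2 / e <= r.
  rewrite /r -ler_pdivrMl//; near: n; exact: (cvgry_ge sqrtn_cvgy).
pose u := t / r.
have tu : t = r * u by rewrite /u mulrC divfK ?gt_eqF.
rewrite -/u {1}tu -mulrBr normrM (gtr0_norm rp).
have u2 : - 2^-1 <= u.
  rewrite /u ler_pdivlMr//.
  have := ler_norm (- t); rewrite normrN; lra.
apply: le_trans (ler_wpM2l (ltW rp) (ln1D_dist u2)) _.
rewrite (_ : r * _ = 2 * t ^+ 2 / r); last by rewrite /u; field; rewrite gt_eqF.
by rewrite ler_pdivrMr// -ler_pdivrMl// mulrC.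
Unshelve. all: by end_near. Qed.

Lemma normal_prob_itvNyo (s t : R) :
  normal_prob 0 s `]-oo, t[%classic = normal_prob 0 s `]-oo, t]%classic.
Proof.
rewrite /normal_prob integral_itv_bndo_bndc//.
by apply/measurable_EFinP; apply: measurable_funTS; exact: measurable_normal_pdf.
Qed.

Context {m d : nat} {disp : measure_display} {Omega : measurableType disp}
  (P : probability Omega R) (lam : 'I_m.+1 -> 'rV[R[i]]_d.+1) (p : 'I_m.+1 -> R)
  (idx : nat -> {RV P >-> 'I_m.+1}).
Hypothesis lam_neq0 : forall i j, lam i ord0 j != 0.
Hypothesis lam_dominant : forall i j,
  Normc.normc (lam i ord0 j) <= Normc.normc (lam i ord0 ord0).
Hypothesis p_ge0 : forall i, 0 <= p i.
Hypothesis p_sum1 : \sum_i p i = 1.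
Hypothesis idx_law : forall k i, P (idx k @^-1` [set i]) = (p i)%:E.
Hypothesis idx_indep : mutually_independent idx.

Let L i := ln (Normc.normc (lam i ord0 ord0)).
Let mean := \sum_i p i * L i.
Let var := \sum_i p i * (L i - mean) ^+ 2.
Let rho_n n : {RV P >-> R} := random_spectral_radius (fun i => diag_mx (lam i)) idx n.
Let rho_oo := asymptotic_spectral_radius p lam.

Let rho_ooE : rho_oo = expR mean.
Proof. exact: (asymptotic_spectral_radius_expR lam_neq0). Qed.

Let rho_oo_gt0 : 0 < rho_oo. Proof. by rewrite rho_ooE expR_gt0. Qed.

(** Centring uses n * mean / n = mean, which is why n = 0 is excluded: there [rho_n] is 1. *)
Let rho_nE n w : (0 < n)%N ->
  rho_n n w = rho_oo * expR ((\sum_(k < n) (L (idx k w) - mean)) / n%:R).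
Proof.
move=> n0; rewrite [LHS]random_spectral_radius_expR// rho_ooE -expRD; congr expR.
rewrite sumrB sumr_const card_ord -mulr_natr; field.
by rewrite pnatr_eq0 -lt0n.
Qed.

(* Exponentiation is increasing, so the delta method reduces to the CLT with a
   threshold depending on n. The free factor [c] gives both normalisations, with
   variance [var_oo] and 1, without a scaling lemma for [normal_prob]. *)
Lemma fluctuation_cdf_cvg (c t : R) : 0 < c -> 0 < var ->
  P [set w | Num.sqrt n%:R * (rho_n n w - rho_oo) * c < t] @[n --> \oo] -->
  normal_prob 0 (c * (rho_oo * Num.sqrt var)) `]-oo, t]%classic.
Proof.
move=> c0 var0; pose k := c * rho_oo.
have k0 : 0 < k by rewrite mulr_gt0.
pose xi i := k * (L i - mean).
have xi_mean : \sum_i p i * xi i = 0.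
  under eq_bigr do rewrite /xi mulrCA mulrBr.
  by rewrite -mulr_sumr sumrB -mulr_suml p_sum1 mul1r -/mean subrr mulr0.
have s0 : 0 < c * (rho_oo * Num.sqrt var) by rewrite !mulr_gt0// sqrtr_gt0.
have xi_var : \sum_i p i * xi i ^+ 2 = (c * (rho_oo * Num.sqrt var)) ^+ 2.
  under eq_bigr do rewrite /xi exprMn mulrCA.
  by rewrite -mulr_sumr -/var /k !exprMn sqr_sqrtr ?mulrA// ltW.
have := normalized_sum_cvg p_ge0 p_sum1 idx_law idx_indep s0 xi_mean xi_var
  (cvg_ln_threshold (t := t) k0).
apply: cvg_trans; apply: near_eq_cvg; near=> n.
have n0 : (0 < n)%N by near: n; exact: nbhs_infty_gt.
have nR : 0 < n%:R :> R by rewrite ltr0n.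
have r0 : 0 < Num.sqrt n%:R :> R by rewrite sqrtr_gt0.
have rr : Num.sqrt n%:R ^+ 2 = n%:R :> R by rewrite sqr_sqrtr// ltW.
set r := Num.sqrt n%:R in r0 rr *.
(* The threshold must be positive before its logarithm can be taken; this holds for large n. *)
have u1 : 0 < 1 + t / (k * r).
  have : `|t| < k * r.
    rewrite -ltr_pdivrMl// /r; near: n; exact: (cvgry_gt sqrtn_cvgy).
  rewrite ltr_norml => /andP[tkr _].
  by rewrite -(ltrD2l (-1)) addKr addr0 ltr_pdivlMr ?mulr_gt0// mulN1r.
congr (P _); apply/funext => w; apply/propext.
rewrite /= normalized_sumE -/r.
set S := \sum_(j < n) (L (idx j w) - mean).
rewrite (_ : \sum_(j < n) xi (idx j w) = k * S); last by rewrite /S mulr_sumr.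
rewrite rho_nE// -/S -rr.
have -> : r * (rho_oo * expR (S / r ^+ 2) - rho_oo) * c = (k * r) * (expR (S / r ^+ 2) - 1).
  by rewrite /k; ring.
have kr0 : 0 < k * r by rewrite mulr_gt0.
have -> : (k * r * (expR (S / r ^+ 2) - 1) < t) = (S / r ^+ 2 < ln (1 + t / (k * r))).
  rewrite mulrC -ltr_pdivlMr// ltrBlDl -[X in _ < X](@lnK R (1 + t / (k * r))) ?posrE//.
  by rewrite ltr_expR.
rewrite (_ : k * S / r = k * r * (S / r ^+ 2)); last by field; rewrite gt_eqF.
by rewrite ltr_pM2l.
Unshelve. all: by end_near. Qed.

Lemma fluctuation_cvg_in_distribution : 0 < var ->
  cvg_in_distribution (fun n => cst (Num.sqrt n%:R) \* (rho_n n \- cst rho_oo) : {RV P >-> R})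
    (normal_prob 0 (rho_oo * Num.sqrt var)).
Proof.
move=> var0; apply: cvg_in_distribution_cdf => t.
have := fluctuation_cdf_cvg (t := t) ltr01 var0.
rewrite mul1r -normal_prob_itvNyo.
by under eq_fun do under eq_set do rewrite mulr1.
Qed.

(** Zero variance forces [L i] = [mean] wherever p i > 0, and indices of weight zero are almost
    surely never drawn. *)
Lemma rho_n_degenerate : var = 0 -> forall n, (0 < n)%N ->
  {ae P, forall w, rho_n n w = rho_oo}.
Proof.
move=> var0 n n0.
have Lmean i : 0 < p i -> L i = mean.
  move=> pi; apply/eqP; rewrite -subr_eq0 -sqrf_eq0.
  have /eqP := var0; rewrite psumr_eq0; last by move=> j _; rewrite mulr_ge0 ?sqr_ge0.
  by move/allP/(_ i (mem_index_enum i)); rewrite mulf_eq0 (gt_eqF pi).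
pose N := \bigcup_k (idx k @^-1` [set i | p i = 0]).
have N0 : P.-negligible N.
  apply: negligible_bigcup => k.
  (* The finite set of weight-zero indices is written as a countable union, again through [inord],
     to fit [negligible_bigcup]. *)
  rewrite (_ : _ @^-1` _ = \bigcup_j
      (idx k @^-1` ([set inord j] `&` [set i | p i = 0]))); last first.
    apply/seteqP; split=> w /=; last by move=> [j _ [->]].
    by move=> pw; exists (idx k w) => //=; rewrite inord_val.
  apply: negligible_bigcup => j; set i : 'I_m.+1 := inord j.
  have [pi|pi] := eqVneq (p i) 0; last first.
    rewrite (_ : _ `&` _ = set0) ?preimage_set0; first exact: negligible_set0.
    by rewrite -subset0 => l [-> /=]; exact/eqP.
  exists (idx k @^-1` [set i]); split; [exact: measurable_idx_preimage| |by move=> w []].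
  by apply: (etrans (idx_law k i)); rewrite pi.
apply: negligibleS N0 => w /= H.
apply: contrapT => wN; apply: H.
rewrite rho_nE// big1 ?mul0r ?expR0 ?mulr1// => k _.
rewrite Lmean ?subrr// lt_neqAle p_ge0 andbT eq_sym; apply/eqP => pk.
by apply: wN; exists k.
Qed.

Lemma fluctuation_degenerate : var = 0 ->
  cvg_in_distribution (fun n => cst (Num.sqrt n%:R) \* (rho_n n \- cst rho_oo) : {RV P >-> R})
    (dirac_law 0).
Proof.
move=> var0 f cf bf.
have mf : measurable_fun setT (EFin \o f).
  by apply/measurable_EFinP; exact: continuous_measurable_fun.
rewrite /dirac_law integral_dirac// diracT mul1e.
rewrite (_ : (fun n => _) = cst (f 0)%:E); first exact: cvg_cst.
apply/funext => n; rewrite unlock.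
set X := (X in f \o X).
rewrite (ae_eq_integral (fun _ => (f 0)%:E))//.
- by rewrite integral_cst//= probability_setT mule1.
- exact: (measurableT_comp (f := EFin \o f)).
(* At n = 0 the factor sqrt 0 makes the fluctuation vanish, although [rho_n] need not equal
   [rho_oo]. *)
- case: n @X => [|n] X.
    by apply: aeW => w _; rewrite /X /= mulr0n sqrtr0 mul0r.
  apply: filterS (rho_n_degenerate var0 (ltn0Sn n)) => w /= H _.
  by rewrite /X /= H subrr mulr0.
Qed.

End delta_method.

(** * Gaussian and degenerate fluctuations of the random spectral radius *)

Theorem theorem2 (R : realType) (m d : nat)
    (lam : 'I_m.+1 -> 'rV[R[i]]_d.+1) (p : 'I_m.+1 -> R)
    (lam_neq0 : forall i j, lam i ord0 j != 0)
    (p_ge0 : forall i, 0 <= p i)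
    (p_sum1 : \sum_(i < m.+1) p i = 1)
    (lam_dominant : forall i,
      \big[Num.max/0]_(r < d.+1 | r != ord0) Normc.normc (lam i ord0 r)
        < Normc.normc (lam i ord0 ord0))
    (disp : measure_display) (Omega : measurableType disp)
    (P : probability Omega R) (idx : nat -> {RV P >-> 'I_m.+1})
    (idx_law : forall (k : nat) (i : 'I_m.+1), P (idx k @^-1` [set i]) = (p i)%:E)
    (idx_indep : mutually_independent idx)
    (dispZ : measure_display) (OmegaZ : measurableType dispZ)
    (PZ : probability OmegaZ R) (Z : {RV PZ >-> R})
    (Z_law : forall B : set R, measurable B ->
      distribution PZ Z B =
        (\sum_(i < m.+1)
          (p i)%:E * \d_(ln (Normc.normc (lam i ord0 ord0))) B)%E) :
  let rho_n n : {RV P >-> R} :=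
    random_spectral_radius (fun i => diag_mx (lam i)) idx n in
  let rho_oo := asymptotic_spectral_radius p lam in
  let var_Z := fine 'V_PZ[Z] in
  let var_oo := rho_oo ^+ 2 * var_Z in
  let fluctuation n : {RV P >-> R} :=
    cst (Num.sqrt n%:R) \* (rho_n n \- cst rho_oo) in
  [/\ ('E_PZ[Z] = (ln rho_oo)%:E)%E,
      cvg_in_distribution fluctuation (normal_law 0 var_oo),
      0 < var_Z ->
        forall x : R,
          P [set w | (rho_n n w - rho_oo)
                       / ((Num.sqrt n%:R)^-1 * Num.sqrt var_oo) < x]
            @[n --> \oo] --> std_normal_cdf x
    & var_Z = 0 ->
        (forall n, (0 < n)%N -> {ae P, forall w, rho_n n w = rho_oo}) /\
        cvg_in_distribution fluctuation (dirac_law 0)].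
Proof.
move=> rho_n rho_oo var_Z var_oo fluctuation.
have dominant i j : Normc.normc (lam i ord0 j) <= Normc.normc (lam i ord0 ord0).
  have [->//|j0] := eqVneq j ord0.
  apply: le_trans (ltW (lam_dominant i)).
  exact: (le_bigmax_cond _ (fun r => Normc.normc (lam i ord0 r)) j0).
have EZ := expectation_discrete p_ge0 Z_law.
have VZ := variance_discrete p_ge0 Z_law.
have var_ZE : var_Z = \sum_i p i * (ln (Normc.normc (lam i ord0 ord0)) -
    \sum_j p j * ln (Normc.normc (lam j ord0 ord0))) ^+ 2.
  by rewrite /var_Z VZ.
have var_ge0 : 0 <= var_Z.
  by rewrite var_ZE sumr_ge0// => i _; rewrite mulr_ge0 ?sqr_ge0.
have rho_gt0 : 0 < rho_oo.
  by rewrite /rho_oo asymptotic_spectral_radius_expR ?expR_gt0.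
have sd_oo : Num.sqrt var_oo = rho_oo * Num.sqrt var_Z.
  by rewrite /var_oo sqrtrM ?sqr_ge0// sqrtr_sqr gtr0_norm.
have degenerate : var_Z = 0 -> cvg_in_distribution fluctuation (dirac_law 0).
  by rewrite var_ZE => v0; exact: fluctuation_degenerate.
split.
- by rewrite EZ /rho_oo asymptotic_spectral_radius_expR// expRK.
- have [v0|v_neq0] := eqVneq var_Z 0.
    rewrite /normal_law (_ : var_oo == 0); first exact: degenerate.
        by rewrite /var_oo v0 mulr0.
  have v_gt0 : 0 < var_Z by rewrite lt_neqAle eq_sym v_neq0.
  rewrite /normal_law gt_eqF ?mulr_gt0 ?exprn_gt0// sd_oo var_ZE.
  by apply: fluctuation_cvg_in_distribution => //; rewrite -var_ZE.
- move=> v_gt0 x.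
  have sd_gt0 : 0 < Num.sqrt var_oo by rewrite sd_oo mulr_gt0 ?sqrtr_gt0.
  have v_gt0' := v_gt0; rewrite var_ZE in v_gt0'.
  (* The free factor of [fluctuation_cdf_cvg] is taken to be this inverse, so that the limiting
     deviation is 1. *)
  have sd_inv_gt0 : 0 < (Num.sqrt var_oo)^-1 by rewrite invr_gt0.
  have := fluctuation_cdf_cvg lam_neq0 dominant p_ge0 p_sum1 idx_law idx_indep
    (t := x) sd_inv_gt0 v_gt0'.
  rewrite -var_ZE -sd_oo mulVf ?gt_eqF//.
  rewrite /std_normal_cdf; apply: cvg_trans; apply: near_eq_cvg; apply: nearW => n.
  congr (P _); apply/funext => w; apply/propext => /=.
  by rewrite invfM invrK mulrA [_ * Num.sqrt n%:R]mulrC.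
- move=> v0; split; last exact: degenerate.
  by move=> n n0; rewrite var_ZE in v0; exact: rho_n_degenerate.
Qed.
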